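(* Let $N \geq 1$ be an integer, $1 \leq p < \infty$ and $u \in C^{\infty}_c(\mathbb{R}^N)$. For $\lambda > 0$, let $$E_{\lambda} := \left\{ (x,y) \in \mathbb{R}^{N} \times \mathbb{R}^{N} : x \ne y, \ \frac{|u(x)-u(y)|}{|x-y|^{\frac{N}{p} + 1}} \geq \lambda \right\}.$$ Then $$\lim_{\lambda \to \infty} \lambda^p \, \mathcal{L}^{2N}(E_{\lambda}) = \frac{k(p,N)}{N} \, \|\nabla u\|_{L^p(\mathbb{R}^N)}^p,$$ where $$k(p,N) := \int_{\mathbb{S}^{N-1}} |e \cdot \omega|^p \, d\omega$$ and $e$ is any unit vector in $\mathbb{R}^N$.
   Context: $C^\infty_c(\mathbb{R}^N)$ is the space of (real-valued) smooth compactly supported functions on $\mathbb{R}^N$; $\mathcal{L}^{2N}$ is Lebesgue measure on $\mathbb{R}^N \times \mathbb{R}^N$; $\|\nabla u\|_{L^p(\mathbb{R}^N)}^p = \int_{\mathbb{R}^N} |\nabla u(x)|^p \, dx$ with $|\cdot|$ the Euclidean norm. $\mathbb{S}^{N-1}$ is the unit sphere in $\mathbb{R}^N$ and $d\omega$ is its standard surface measure (for $N=1$, counting measure on $\{-1,1\}$). By rotation invariance $k(p,N)$ does not depend on the choice of $e$. *)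

(* Defs.v *)
From HB Require Import structures.
From mathcomp Require Import all_boot all_order all_algebra.
From mathcomp Require Import all_classical all_reals all_analysis.
From mathcomp Require Import measurable_realfun.

Set Implicit Arguments.
Unset Strict Implicit.
Unset Printing Implicit Defensive.

Import Order.TTheory GRing.Theory Num.Theory.
Import numFieldNormedType.Exports.

Local Open Scope classical_set_scope.
Local Open Scope ring_scope.

(* R^n is 'rV[R]_n. Its normed-module norm `|x| is the sup norm: it is only
   used for its topology, the Euclidean norm being enorm below. *)

Section euclidean.
Context {R : realType} {n : nat}.
Implicit Types x y : 'rV[R]_n.

Definition dotp x y : R := \sum_(i < n) x ord0 i * y ord0 i.

Definition enorm x : R := Num.sqrt (dotp x x).

Definition unit_sphere : set 'rV[R]_n := [set x | enorm x = 1].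

End euclidean.
Arguments unit_sphere : clear implicits.

Section smooth.
Context {R : realType} {n : nat}.
Implicit Types u : 'rV[R]_n -> R.

Definition basis_rV (i : 'I_n) : 'rV[R]_n := delta_mx ord0 i.

Fixpoint class_C (k : nat) u : Prop :=
  if k is k'.+1 then
    continuous u /\
    forall i, (forall x, derivable u x (basis_rV i)) /\
              class_C k' (fun x => 'D_(basis_rV i) u x)
  else continuous u.

Definition smooth u := forall k, class_C k u.

Definition compactly_supported u := compact (closure [set x | u x != 0]).

Definition grad u (x : 'rV[R]_n) : 'rV[R]_n := \row_i 'D_(basis_rV i) u x.

End smooth.

(* The sigma-algebra on R^n generated by the coordinates, i.e. the Borel
   sigma-algebra; same construction as the library's one for n.-tuple T. *)
Definition measure_rV_display : measure_display -> measure_display.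
Proof. exact. Qed.

Section measurable_rV.
Context {R : realType} {n : nat}.

Let coors : 'I_n -> 'rV[R]_n -> R := fun i x => x ord0 i.

Let rV_set0 : g_sigma_preimage coors set0.
Proof. exact: sigma_algebra0. Qed.

Let rV_setC A : g_sigma_preimage coors A -> g_sigma_preimage coors (~` A).
Proof. exact: sigma_algebraC. Qed.

Let rV_bigcup (F : _^nat) : (forall i, g_sigma_preimage coors (F i)) ->
  g_sigma_preimage coors (\bigcup_i (F i)).
Proof. exact: sigma_algebra_bigcup. Qed.

HB.instance Definition _ :=
  @isMeasurable.Build (measure_rV_display default_measure_display)
  'rV[R]_n (g_sigma_preimage coors) rV_set0 rV_setC rV_bigcup.

Lemma measurable_coord (i : 'I_n) :
  measurable_fun [set: 'rV[R]_n] (fun x : 'rV[R]_n => x ord0 i).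
Proof.
move=> _ Y mY; rewrite setTI; apply: sub_sigma_algebra => /=.
rewrite -bigcup_seq/=; exists i => /=; first by rewrite mem_index_enum.
by exists Y => //; rewrite setTI.
Qed.

Lemma measurable_fun_coordP d (T : measurableType d) (f : T -> 'rV[R]_n) :
  measurable_fun [set: T] f <->
  forall i, measurable_fun [set: T] (fun t => f t ord0 i).
Proof.
split=> [mf i|mf].
  exact: (measurableT_comp (measurable_coord i) mf).
apply: measurability => //= _ [A + <-].
rewrite -bigcup_seq/= => -[i _ [B mB <-]].
by rewrite setTI; exact: mf.
Qed.

End measurable_rV.

Section sigma_finite_pack.
Context d (T : measurableType d) {R : realType}.
Variables (m : {measure set T -> \bar R}) (sm : sigma_finite setT m).

Definition sigma_finite_copy : set T -> \bar R := m.

HB.instance Definition _ := Measure.on sigma_finite_copy.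

HB.instance Definition _ :=
  Measure_isSigmaFinite.Build _ _ _ sigma_finite_copy sm.

Definition sigma_finite_pack : {sigma_finite_measure set T -> \bar R} :=
  sigma_finite_copy.

End sigma_finite_pack.

Section lebesgue_rV.
Context {R : realType}.
Local Open Scope ereal_scope.

Definition cons_rV {n} (p : measurableTypeR R * 'rV[R]_n) : 'rV[R]_n.+1 :=
  row_mx p.1%:M p.2 : 'rV[R]_(1 + n).

Lemma measurable_cons_rV n : measurable_fun setT (@cons_rV n).
Proof.
apply/measurable_fun_coordP => i; rewrite /cons_rV.
case: (@split_ordP 1 n i) => j ->.
  rewrite (_ : (fun _ => _) = fst) //; apply/funext => p.
  by rewrite (row_mxEl p.1%:M p.2) mxE !ord1 eqxx mulr1n.
rewrite (_ : (fun _ => _) = (fun x : 'rV[R]_n => x ord0 j) \o snd).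
  exact: measurableT_comp (measurable_coord j) measurable_snd.
by apply/funext => p; rewrite (row_mxEr p.1%:M p.2).
Qed.

(* Lebesgue measure on R^n, as an iterated product of the one on R. *)
Fixpoint lebesgue_rV (n : nat) : set 'rV[R]_n -> \bar R :=
  match n with
  | 0%N => dirac (0%R : 'rV[R]_0)
  | n'.+1 => pushforward (@lebesgue_measure R \x @lebesgue_rV n') cons_rV
  end.

Definition uncons_rV {n} (x : 'rV[R]_n.+1) : measurableTypeR R * 'rV[R]_n :=
  ((x : 'rV[R]_(1 + n)) ord0 ord0, rsubmx (x : 'rV[R]_(1 + n))).

Lemma cons_rVK n : cancel (@cons_rV n) uncons_rV.
Proof.
move=> [a x]; rewrite /uncons_rV /cons_rV /=; congr pair.
  rewrite (_ : ord0 = lshift n ord0 :> 'I_(1 + n)); last exact/val_inj.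
  by rewrite row_mxEl mxE eqxx mulr1n.
exact: row_mxKr.
Qed.

Lemma uncons_rVK n : cancel (@uncons_rV n) cons_rV.
Proof.
move=> x; rewrite /cons_rV /uncons_rV /=.
have -> : (x ord0 ord0)%:M = lsubmx (x : 'rV[R]_(1 + n)).
  by rewrite [RHS]mx11_scalar mxE; congr (x _ _)%:M; exact/val_inj.
exact: (@hsubmxK _ 1 1 n x).
Qed.

Lemma measurable_uncons_rV n : measurable_fun setT (@uncons_rV n).
Proof.
apply/measurable_fun_pair; first exact: measurable_coord.
apply/measurable_fun_coordP => i.
rewrite (_ : (fun _ => _) = fun x : 'rV[R]_n.+1 => x ord0 (rshift 1 i)).
  exact: measurable_coord.
by apply/funext => x; rewrite mxE.
Qed.

Lemma lebesgue_rV_sigma_finite_measure n :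
  {m : {sigma_finite_measure set 'rV[R]_n -> \bar R} |
    (m : set _ -> \bar R) = @lebesgue_rV n}.
Proof.
elim: n => [|n [m mE]] /=.
  by exists (dirac (0%R : 'rV[R]_0)).
pose l : {sigma_finite_measure set (measurableTypeR R) -> \bar R} :=
  @lebesgue_measure R.
pose P : {measure set _ -> \bar R} := l \x m.
pose Mm : {measure set 'rV[R]_n.+1 -> \bar R} :=
  measure_function_pushforward__canonical__measure_function_Measure
    P (@measurable_cons_rV n).
have sM : sigma_finite setT Mm.
  have /sigma_finiteP[F [TF ndF Foo]] := sigma_finiteT l.
  have /sigma_finiteP[G [TG ndG Goo]] := sigma_finiteT m.
  exists (fun i => uncons_rV @^-1` (F i `*` G i)).
    apply/seteqP; split=> // x _.
    have [i _ Fi] : (\bigcup_i F i) (uncons_rV x).1 by rewrite -TF.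
    have [j _ Gj] : (\bigcup_i G i) (uncons_rV x).2 by rewrite -TG.
    exists (maxn i j) => //; split.
      by move: Fi; exact/subsetPset/ndF/leq_maxl.
    by move: Gj; exact/subsetPset/ndG/leq_maxr.
  move=> i; have [mF Fioo] := Foo i; have [mG Gioo] := Goo i; split.
    rewrite -[X in measurable X]setTI; apply: measurable_uncons_rV => //.
    exact: measurableX.
  rewrite /Mm/= /pushforward -comp_preimage.
  rewrite (_ : _ @^-1` (F i `*` G i) = F i `*` G i); last first.
    by rewrite (_ : _ \o _ = id) //; apply/funext => p /=; rewrite cons_rVK.
  by rewrite product_measure1E// lte_mul_pinfty// ge0_fin_numE.
exists (sigma_finite_pack sM).
by rewrite /= -mE.
Qed.

Section lebesgue_rV_measure.
Variable n : nat.

Let lebesgue_rV0 : @lebesgue_rV n set0 = 0.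
Proof. by have [m <-] := lebesgue_rV_sigma_finite_measure n. Qed.

Let lebesgue_rV_ge0 A : 0 <= @lebesgue_rV n A.
Proof. by have [m <-] := lebesgue_rV_sigma_finite_measure n. Qed.

Let lebesgue_rV_sigma_additive : semi_sigma_additive (@lebesgue_rV n).
Proof.
have [m <-] := lebesgue_rV_sigma_finite_measure n.
exact: measure_semi_sigma_additive.
Qed.

HB.instance Definition _ := isMeasure.Build _ _ _ (@lebesgue_rV n)
  lebesgue_rV0 lebesgue_rV_ge0 lebesgue_rV_sigma_additive.

Let lebesgue_rV_sigma_finite : sigma_finite setT (@lebesgue_rV n).
Proof.
have [m <-] := lebesgue_rV_sigma_finite_measure n.
exact: sigma_finiteT.
Qed.

HB.instance Definition _ := Measure_isSigmaFinite.Build _ _ _ (@lebesgue_rV n)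
  lebesgue_rV_sigma_finite.

End lebesgue_rV_measure.

End lebesgue_rV.
Arguments lebesgue_rV {R} n.

Section surface_measure.
Context {R : realType} {n : nat}.
Local Open Scope ereal_scope.

(* The cone over a subset A of the unit sphere. *)
Definition cone (A : set 'rV[R]_n) : set 'rV[R]_n :=
  [set x | (0 < enorm x <= 1)%R /\ A ((enorm x)^-1 *: x)%R].

(* Surface measure of the unit sphere of R^n, n >= 1, seen as a measure on R^n:
   sigma(A) = n * L^n {r w | w in A, 0 < r <= 1}. For n = 1 this is the
   counting measure on {-1, 1}. *)
Definition surface_measure (A : set 'rV[R]_n) : \bar R :=
  n%:R%:E * lebesgue_rV n (cone A).

Lemma measurable_enorm : measurable_fun setT (@enorm R n).
Proof.
apply: (@measurableT_comp _ _ _ _ _ _ (@Num.sqrt R)).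
  by apply: continuous_measurable_fun; exact: sqrt_continuous.
apply: measurable_sum => i.
by apply: measurable_funM; exact: measurable_coord.
Qed.

Lemma measurable_normalize :
  measurable_fun setT (fun x : 'rV[R]_n => (enorm x)^-1 *: x)%R.
Proof.
apply/measurable_fun_coordP => i.
rewrite (_ : (fun _ => _) =
    (fun x : 'rV[R]_n => enorm x `^ (-1) * x ord0 i)%R); last first.
  by apply/funext => x; rewrite !mxE powR_inv1// sqrtr_ge0.
apply: measurable_funM; last exact: measurable_coord.
apply: (measurableT_comp (measurable_powR _)); exact: measurable_enorm.
Qed.

Lemma measurable_cone A : measurable A -> measurable (cone A).
Proof.
move=> mA.
have -> : cone A = (@enorm R n @^-1` `]0%R, 1%R]) `&`
    ((fun x : 'rV[R]_n => (enorm x)^-1 *: x)%R @^-1` A).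
  by apply/seteqP; split=> x /=; rewrite in_itv.
apply: measurableI; rewrite -[X in measurable X]setTI.
  exact: measurable_enorm.
exact: measurable_normalize.
Qed.

Let surface_measure0 : surface_measure set0 = 0.
Proof.
rewrite /surface_measure (_ : cone set0 = set0) ?measure0 ?mule0//.
by apply/seteqP; split=> x // [].
Qed.

Let surface_measure_ge0 A : 0 <= surface_measure A.
Proof. by rewrite mule_ge0// lee_fin. Qed.

Let surface_measure_sigma_additive : semi_sigma_additive surface_measure.
Proof.
move=> F mF tF mUF; rewrite /surface_measure.
have -> : cone (\bigcup_k F k) = \bigcup_k cone (F k).
  by apply/seteqP; split=> [x [xn [k _ Fk]]|x [k _ [xn Fk]]];
    [exists k | split=> //; exists k].
under eq_fun do rewrite -ge0_sume_distrr//.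
apply: cvgeZl => //; apply: measure_semi_sigma_additive.
- by move=> k; exact: measurable_cone.
- move=> i j _ _ [x [[_ Fi] [_ Fj]]].
  by apply: tF => //; exists ((enorm x)^-1 *: x)%R.
- by apply: bigcup_measurable => k _; exact: measurable_cone.
Qed.

HB.instance Definition _ := isMeasure.Build _ _ _ surface_measure
  surface_measure0 surface_measure_ge0 surface_measure_sigma_additive.

End surface_measure.
Arguments surface_measure {R} n.

Section BvSY.
Context {R : realType} {N : nat}.
Local Open Scope ereal_scope.

Definition k_const (p : R) (e : 'rV[R]_N) : \bar R :=
  \int[surface_measure N]_(w in unit_sphere R N) (`|dotp e w| `^ p)%:E.

Definition gradient_energy (p : R) (u : 'rV[R]_N -> R) : \bar R :=
  \int[lebesgue_rV N]_x (enorm (grad u x) `^ p)%:E.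

Definition E_set (p : R) (u : 'rV[R]_N -> R) (lambda : R) :
    set ('rV[R]_N * 'rV[R]_N) :=
  [set xy | xy.1 <> xy.2 /\
    (lambda <= `|u xy.1 - u xy.2| / enorm (xy.1 - xy.2) `^ (N%:R / p + 1))%R].

End BvSY.

(* Main.v *)
Require Import Defs.
From mathcomp Require Import all_boot all_order all_algebra.
From mathcomp Require Import all_classical all_reals all_analysis.
From mathcomp Require Import measurable_realfun.
From mathcomp Require Import ring lra.
Import Order.TTheory GRing.Theory Num.Theory.
Import numFieldNormedType.Exports.

(* Write eps = lambda^(-p/N) and y = x + eps t in each x-section of E_lambda.
   Since L^N scales by eps^N = lambda^(-p), lambda^p L^2N(E_lambda) is the
   integral over x of the measure of
     {t <> 0 | |t|^(N/p+1) <= |u(x + eps t) - u(x)| / eps},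
   and by dominated convergence (u is Lipschitz with bounded support) this tends
   to the integral of V(grad u(x)), where V(g) is the measure of
     {t <> 0 | |t|^(N/p+1) <= |g . t|};
   the boundary of the latter region is negligible. Scaling and invariance under
   reflections give V(g) = |g|^p V(e) for a unit vector e, and polar coordinates
   give V(e) = k(p, N) / N. *)

Set Implicit Arguments.
Unset Strict Implicit.
Unset Printing Implicit Defensive.

Local Open Scope classical_set_scope.
Local Open Scope ring_scope.

(** * Lebesgue measure on row vectors *)

(** Only translation invariance is read off the construction of [lebesgue_rV]. Scaling, central
    symmetry and invariance under isometries all follow from it by double counting: a map that
    carries translations to translations multiplies measure by a constant, and a test set (a cube,
    the unit ball) reveals that constant. No determinant and no general rotation occurs, because a
    single reflection takes one given unit vector to another. The surface measure is itself built
    from cones, so the polar-coordinate step compares a Lebesgue integral over the punctured unit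
    ball with the Lebesgue measure of a region. Both are computed in a product with the line, by
    alternating between the two families of slices. Dominated convergence is used twice, inside each
    section and then over [x]. The Lipschitz bound confines [t] to a ball independent of [x] and
    [eps], and compact support then confines [x]. *)

Section lebesgue_shift1.
Context {R : realType}.

(** The pushforward by a translation gives half-open intervals their length, and this characterizes
    Lebesgue measure. *)
Lemma lebesgue_measure_shift (a : R) (A : set (measurableTypeR R)) :
  measurable A ->
  lebesgue_measure ((fun x : R => x + a) @^-1` A) = lebesgue_measure A.
Proof.
move=> mA.
have mf : measurable_fun setT ((fun x : R => x + a) : measurableTypeR R -> measurableTypeR R).
  by apply: measurable_funD.
pose m : {measure set (measurableTypeR R) -> \bar R} :=
  measure_function_pushforward__canonical__measure_function_Measure
    lebesgue_measure mf.
rewrite -[LHS]/(m A); apply/esym/lebesgue_measure_unique => //= _ [[b c]] _ <-.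
rewrite /pushforward.
rewrite (_ : _ @^-1` _ = `]b - a, c - a]%classic); last first.
  by apply/seteqP; split=> x /=; rewrite !in_itv/= ltrBlDr lerBrDr.
rewrite !lebesgue_measure_itv/= !lte_fin ltrD2r -!EFinB.
by case: ifP => // _; congr EFin; ring.
Qed.
End lebesgue_shift1.

Section lebesgue_rV_theory.
Context {R : realType}.

Lemma measurable_rV_add n d (T : measurableType d) (f g : T -> 'rV[R]_n) :
  measurable_fun setT f -> measurable_fun setT g ->
  measurable_fun setT (fun x => f x + g x).
Proof.
move=> /measurable_fun_coordP mf /measurable_fun_coordP mg.
apply/measurable_fun_coordP => i; under eq_fun do rewrite mxE.
exact: measurable_funD.
Qed.

Lemma measurable_rV_scale n d (T : measurableType d) (f : T -> R)
    (g : T -> 'rV[R]_n) :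
  measurable_fun setT f -> measurable_fun setT g ->
  measurable_fun setT (fun x => f x *: g x).
Proof.
move=> mf /measurable_fun_coordP mg.
apply/measurable_fun_coordP => i; under eq_fun do rewrite mxE.
exact: measurable_funM.
Qed.

Lemma measurable_rV_opp n d (T : measurableType d) (f : T -> 'rV[R]_n) :
  measurable_fun setT f -> measurable_fun setT (fun x => - f x).
Proof.
move=> mf; under eq_fun do rewrite -scaleN1r.
exact: measurable_rV_scale.
Qed.

Lemma measurable_rV_preimage d d' (T : measurableType d) (U : measurableType d') (f : T -> U) A :
  measurable_fun setT f -> measurable A -> measurable (f @^-1` A).
Proof. by move=> mf mA; rewrite -[X in measurable X]setTI; exact: mf. Qed.

Lemma cons_rVD n (p : measurableTypeR R * 'rV[R]_n) (a : 'rV[R]_n.+1) :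
  cons_rV p + a = cons_rV (p.1 + (uncons_rV a).1, p.2 + (uncons_rV a).2).
Proof.
rewrite -{1}(uncons_rVK a) /cons_rV; set b := uncons_rV a.
by rewrite (@add_row_mx _ 1 1 n) -raddfD.
Qed.

(** Induction on the dimension: a product measure is determined by its rectangles, and on these the
    translate splits into the one-dimensional case and the induction hypothesis. *)
Lemma lebesgue_rV_shift n (a : 'rV[R]_n) (A : set 'rV[R]_n) : measurable A ->
  lebesgue_rV n ((fun x => x + a) @^-1` A) = lebesgue_rV n A.
Proof.
elim: n => [|n IH] in a A *.
  move=> mA; congr lebesgue_rV; apply/seteqP; split=> x /=;
  by rewrite (_ : x + a = x)// (thinmx0 (x + a)) (thinmx0 x).
move=> mA /=.
pose l : {sigma_finite_measure set (measurableTypeR R) -> \bar R} :=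
  @lebesgue_measure R.
pose L : {sigma_finite_measure set 'rV[R]_n -> \bar R} := @lebesgue_rV R n.
pose s (p : measurableTypeR R * 'rV[R]_n) : measurableTypeR R * 'rV[R]_n :=
  (p.1 + (uncons_rV a).1, p.2 + (uncons_rV a).2).
have ms : measurable_fun setT s.
  apply/measurable_fun_pair => /=; first exact: measurable_funD.
  exact: measurable_rV_add.
pose m : {measure set (measurableTypeR R * 'rV[R]_n) -> \bar R} :=
  measure_function_pushforward__canonical__measure_function_Measure
    (l \x L)%E ms.
have mcA : measurable (@cons_rV R n @^-1` A).
  by apply: measurable_rV_preimage => //; exact: measurable_cons_rV.
transitivity (m (cons_rV @^-1` A)).
  rewrite /m /= /pushforward; congr (product_measure1 _ _ _).
  apply/seteqP; split=> -[x y] /=; by rewrite cons_rVD.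
apply/esym; apply: (@product_measure_unique _ _ _ _ _ l L m) => // B C mB mC.
have -> : (l B * L C = l ((fun x => x + (uncons_rV a).1)%R @^-1` B) *
    L ((fun x => x + (uncons_rV a).2)%R @^-1` C))%E.
  by congr (_ * _)%E; apply: esym; [exact: lebesgue_measure_shift|exact: IH].
rewrite -(product_measure1E l L).
- by rewrite /m /= /pushforward.
- by rewrite -[X in measurable X]setTI; exact: measurable_funD.
- rewrite -[X in measurable X]setTI.
  by apply: (@measurable_rV_add _ _ _ idfun (cst _)) => //; exact: measurable_id.
Qed.
End lebesgue_rV_theory.

Section product_sections.
Context d1 d2 (T1 : measurableType d1) (T2 : measurableType d2) {R : realType}.
Variable m1 : {sigma_finite_measure set T1 -> \bar R}.
Variable m2 : {sigma_finite_measure set T2 -> \bar R}.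
Local Open Scope ereal_scope.

(** The product [\x] integrates x-sections and [\x^] integrates y-sections; they agree on
    rectangles, hence everywhere. *)
Lemma product_measure1_ysection (A : set (T1 * T2)) : measurable A ->
  (m1 \x m2) A = \int[m2]_y m1 (ysection A y).
Proof.
move=> mA; rewrite -[RHS]/((m1 \x^ m2) A).
by apply: product_measure_unique => //= B C mB mC; rewrite product_measure2E.
Qed.

End product_sections.

(** * Maps that carry translations to translations *)

Section lebesgue_rV_transformation.
Context {R : realType} (n : nat).
Local Notation V := 'rV[R]_n.
Local Notation L := (@lebesgue_rV R n).
Local Open Scope ereal_scope.

Lemma integral_lebesgue_rV_indicZ (A : set V) (c : \bar R) (f : V -> \bar R) :
  measurable A -> 0 <= c -> (forall x, f x = (\1_A x)%:E * c) ->
  \int[L]_x f x = L A * c.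
Proof.
move=> mA c0 fE; rewrite (eq_integral (fun x => (\1_A x)%:E * c)); last first.
  by move=> x _; exact: fE.
rewrite ge0_integralZr//; first by rewrite integral_indic// setIT.
exact/measurable_EFinP/measurable_indic.
Qed.

Definition box (a b : R) : set V := [set x | forall i, (a <= x ord0 i < b)%R].

Lemma measurable_box a b : measurable (box a b).
Proof.
rewrite (_ : box a b =
    \bigcap_(i in [set: 'I_n]) ((fun x : V => x ord0 i) @^-1` `[a, b[)).
  apply: fin_bigcap_measurable => // i _.
  by apply: measurable_rV_preimage => //; exact: measurable_coord.
apply/seteqP; split=> [x xB i _|x xB i]; first by rewrite /= in_itv; exact: xB.
by have := xB i Logic.I; rewrite /= in_itv.
Qed.

(* Haar-type uniqueness argument: evaluate the measure of
   {(x, y) | A (T x) /\ B (y + T x)} along both families of sections. *)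
Lemma lebesgue_rV_transform (T S : V -> V) (A B : set V) :
  measurable_fun setT T -> (forall x y, T (x - S y) = T x - y)%R ->
  measurable A -> measurable B ->
  L (T @^-1` A) * L B = L (T @^-1` B) * L (-%R @^-1` A).
Proof.
move=> mT TS mA mB.
pose P1 := [set z : V * V | A (T z.1) /\ B (z.2 + T z.1)%R].
pose P2 := [set z : V * V | A (T z.1 - z.2)%R /\ B (T z.1)].
have mT1 : measurable_fun setT (fun z : V * V => T z.1).
  exact: measurableT_comp.
have mP1 : measurable P1.
  apply: measurableI; first exact: (measurable_rV_preimage mT1).
  apply: (measurable_rV_preimage _ mB).
  by apply: measurable_rV_add => //; exact: measurable_snd.
have mP2 : measurable P2.
  apply: measurableI; last exact: (measurable_rV_preimage mT1).
  apply: (measurable_rV_preimage _ mA).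
  by apply: measurable_rV_add => //; apply: measurable_rV_opp; exact: measurable_snd.
have mNA : measurable (-%R @^-1` A : set V).
  apply: (measurable_rV_preimage _ mA).
  by apply: (@measurable_rV_opp _ _ _ _ idfun); exact: measurable_id.
transitivity ((L \x L) P1).
  rewrite -[RHS]/(\int[L]_x (L \o xsection P1) x); apply/esym.
  apply: integral_lebesgue_rV_indicZ => //=.
  - exact: measurable_rV_preimage.
  - move=> x; rewrite indicE; have [/set_mem Ax|/negP xA] := boolP (x \in _).
      rewrite mul1e -(lebesgue_rV_shift (T x) mB); congr (lebesgue_rV _ _).
      by apply/seteqP; split=> y; rewrite /xsection/= inE /P1/=; [case|split].
    rewrite mul0e (_ : xsection _ _ = set0)//.
    apply/seteqP; split=> y//; rewrite /xsection/= inE /P1/= => -[Ax _].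
    by apply: xA; rewrite inE.
(* Translating the y-section of [P1] by [S y] replaces [T x] by [T x - y], which turns the two
   conditions into those of [P2]. *)
transitivity ((L \x L) P2).
  rewrite !product_measure1_ysection//; apply: eq_integral => y _ /=.
  rewrite -(lebesgue_rV_shift (- S y)%R (measurable_ysection y mP1)).
  congr (lebesgue_rV _ _); apply/seteqP; split=> x;
    by rewrite /ysection/= !inE /P1 /P2/= TS (addrCA y) subrr addr0.
rewrite -[LHS]/(\int[L]_x (L \o xsection P2) x).
apply: integral_lebesgue_rV_indicZ => //=.
- exact: measurable_rV_preimage.
- move=> x; rewrite indicE; have [/set_mem Ax|/negP xA] := boolP (x \in _).
    rewrite mul1e -(lebesgue_rV_shift (- T x)%R mNA); congr (lebesgue_rV _ _).
    apply/seteqP; split=> y; rewrite /xsection/= inE /P2/= opprB; [by case|by split].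
  rewrite mul0e (_ : xsection _ _ = set0)//.
  apply/seteqP; split=> y//; rewrite /xsection/= inE /P2/= => -[_ Ax].
  by apply: xA; rewrite inE.
Qed.

End lebesgue_rV_transformation.
Arguments box {R} n a b.

Section lebesgue_rV_box.
Context {R : realType}.
Local Open Scope ereal_scope.

Lemma lebesgue_rV_box n (a b : R) : (a <= b)%R ->
  lebesgue_rV n (box n a b) = ((b - a) ^+ n)%:E.
Proof.
move=> ab; elim: n => [|n IH].
  by rewrite expr0 /= diracE mem_set// => -[].
rewrite [LHS]/= /pushforward.
rewrite (_ : _ @^-1` _ = `[a, b[%classic `*` box n a b); last first.
  apply/seteqP; split => [[x y] /= xyB|[x y] [/= xab yB] i].
    split=> /= [|i].
      have := xyB (lshift n (ord0 : 'I_1)).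
      by rewrite /cons_rV (@row_mxEl _ 1 1 n) mxE eqxx mulr1n in_itv.
    by have := xyB (rshift 1 i); rewrite /cons_rV (@row_mxEr _ 1 1 n).
  rewrite /cons_rV; case: (@split_ordP 1 n i) => j ->.
    by rewrite (@row_mxEl _ 1 1 n) mxE !ord1 eqxx mulr1n; rewrite in_itv in xab.
  by rewrite (@row_mxEr _ 1 1 n); exact: yB.
rewrite product_measure1E//; last exact: measurable_box.
rewrite /= IH lebesgue_measure_itv/= lte_fin exprS EFinM.
by move: ab; rewrite le_eqVlt => /predU1P[->|->]//; rewrite ltxx subrr mul0e.
Qed.

Lemma lebesgue_rV_box_lty n (a b : R) : lebesgue_rV n (box n a b) < +oo.
Proof.
have [ab|ba] := leP a b; first by rewrite lebesgue_rV_box// ltry.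
(* For [b < a] the box is empty unless [n = 0], when it is the whole space; [box n a a] contains it
   in both cases. *)
apply: (@le_lt_trans _ _ (lebesgue_rV n (box n a a))).
  apply: le_measure; rewrite ?inE; try exact: measurable_box.
  by move=> x xB i; have /andP[-> /lt_trans] /= := xB i; apply.
by rewrite lebesgue_rV_box// ltry.
Qed.

End lebesgue_rV_box.

(** * Euclidean geometry and invariances of Lebesgue measure *)

Section euclidean_theory.
Context {R : realType} {n : nat}.
Implicit Types (x y z : 'rV[R]_n) (a : R).

Lemma dotpC x y : dotp x y = dotp y x.
Proof. by apply: eq_bigr => i _; rewrite mulrC. Qed.

Lemma dotpDr x y z : dotp x (y + z) = dotp x y + dotp x z.
Proof.
by rewrite /dotp -big_split; apply: eq_bigr => i _; rewrite mxE mulrDr.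
Qed.

Lemma dotpZr a x y : dotp x (a *: y) = a * dotp x y.
Proof.
by rewrite /dotp mulr_sumr; apply: eq_bigr => i _; rewrite mxE; ring.
Qed.

Lemma dotpNr x y : dotp x (- y) = - dotp x y.
Proof. by rewrite -scaleN1r dotpZr mulN1r. Qed.

Lemma dotpDl x y z : dotp (x + y) z = dotp x z + dotp y z.
Proof. by rewrite !(dotpC _ z) dotpDr. Qed.

Lemma dotpZl a x y : dotp (a *: x) y = a * dotp x y.
Proof. by rewrite !(dotpC _ y) dotpZr. Qed.

Lemma dotpNl x y : dotp (- x) y = - dotp x y.
Proof. by rewrite !(dotpC _ y) dotpNr. Qed.

Lemma dotp_ge0 x : 0 <= dotp x x.
Proof. by apply: sumr_ge0 => i _; rewrite -expr2 sqr_ge0. Qed.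

Lemma dotp_eq0 x : dotp x x = 0 -> x = 0.
Proof.
move=> /eqP; rewrite psumr_eq0 => [/allP x0|i _]; last by rewrite -expr2 sqr_ge0.
apply/rowP => i; rewrite mxE; apply/eqP.
by have := x0 i (mem_index_enum _); rewrite /= -expr2 sqrf_eq0.
Qed.

Lemma enorm_ge0 x : 0 <= enorm x.
Proof. exact: sqrtr_ge0. Qed.

Lemma sqr_enorm x : enorm x ^+ 2 = dotp x x.
Proof. by rewrite sqr_sqrtr// dotp_ge0. Qed.

Lemma enormZ a x : enorm (a *: x) = `|a| * enorm x.
Proof.
by rewrite /enorm dotpZl dotpZr mulrA -expr2 sqrtrM ?sqr_ge0// sqrtr_sqr.
Qed.

Lemma enormN x : enorm (- x) = enorm x.
Proof. by rewrite -scaleN1r enormZ normrN1 mul1r. Qed.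

Lemma enorm_eq0 x : enorm x = 0 -> x = 0.
Proof. by move=> x0; apply: dotp_eq0; rewrite -sqr_enorm x0 expr0n. Qed.

Lemma enorm0 : enorm (0 : 'rV[R]_n) = 0.
Proof. by rewrite -(scale0r 0) enormZ normr0 mul0r. Qed.

Lemma enorm_gt0 x : x <> 0 -> 0 < enorm x.
Proof.
by move=> x0; rewrite lt0r enorm_ge0 andbT; apply/eqP => /enorm_eq0.
Qed.

Lemma enorm_gt0P x : x <> 0 <-> 0 < enorm x.
Proof. by split=> [/enorm_gt0//|x0 xE]; move: x0; rewrite xE enorm0 ltxx. Qed.

Lemma enorm_normalize x : x <> 0 -> enorm ((enorm x)^-1 *: x) = 1.
Proof.
move=> /enorm_gt0 x0.
by rewrite enormZ gtr0_norm ?invr_gt0// mulVf// gt_eqF.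
Qed.

Lemma coord_le_enorm x i : `|x ord0 i| <= enorm x.
Proof.
rewrite -(ler_sqr (normr_ge0 _) (enorm_ge0 x)) sqr_enorm real_normK ?num_real//.
rewrite /dotp (bigD1 i)//= -expr2 lerDl.
by apply: sumr_ge0 => j _; rewrite -expr2 sqr_ge0.
Qed.

Lemma dotp_unit_le e x : enorm e = 1 -> `|dotp e x| <= enorm x.
Proof.
move=> e1; have ee : dotp e e = 1 by rewrite -sqr_enorm e1 expr1n.
rewrite -(ler_sqr (normr_ge0 _) (enorm_ge0 x)) sqr_enorm real_normK ?num_real//.
have := dotp_ge0 (x - dotp e x *: e).
rewrite !(dotpDl, dotpDr, dotpNl, dotpNr, dotpZl, dotpZr) ee (dotpC x e).
by move: (dotp e x) (dotp x x) => a b; nra.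
Qed.

Lemma measurable_dotp d (T : measurableType d) (f g : T -> 'rV[R]_n) :
  measurable_fun setT f -> measurable_fun setT g ->
  measurable_fun setT (fun t => dotp (f t) (g t)).
Proof.
move=> /measurable_fun_coordP mf /measurable_fun_coordP mg.
by apply: measurable_sum => i; exact: measurable_funM.
Qed.

Lemma measurable_enorm_comp d (T : measurableType d) (f : T -> 'rV[R]_n) :
  measurable_fun setT f -> measurable_fun setT (fun t => enorm (f t)).
Proof. by move=> mf; apply: (measurableT_comp measurable_enorm). Qed.

(* The reflection through the hyperplane orthogonal to e - g. *)
Lemma exists_reflection (e g : 'rV[R]_n) : enorm e = 1 -> enorm g = 1 ->
  exists T : 'rV[R]_n -> 'rV[R]_n,
    [/\ measurable_fun setT T, forall x y, T (x - T y) = T x - y,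
        forall x, enorm (T x) = enorm x & forall x, dotp g (T x) = dotp e x].
Proof.
move=> e1 g1; have [->|/eqP ge] := eqVneq g e.
  by exists id; split=> //; exact: measurable_id.
have ee : dotp e e = 1 by rewrite -sqr_enorm e1 expr1n.
have gg : dotp g g = 1 by rewrite -sqr_enorm g1 expr1n.
have [v vE] : exists v, v = g - e by exists (g - e).
pose c := 2 / dotp v v.
have vv : dotp v v = 2 - 2 * dotp g e.
  by rewrite vE !(dotpDl, dotpDr, dotpNl, dotpNr) ee gg (dotpC e g); ring.
have vv0 : dotp v v != 0.
  by apply/eqP => /dotp_eq0/eqP; rewrite vE subr_eq0 => /eqP.
have cvv : c * dotp v v = 2 by rewrite divfK.
pose T x := x - (c * dotp v x) *: v.
have TB x y : T (x - y) = T x - T y.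
  by apply/rowP => i; rewrite /T dotpDr dotpNr !mxE; ring.
have vT x : dotp v (T x) = - dotp v x.
  by rewrite dotpDr dotpNr dotpZr mulrAC cvv; ring.
have TK x : T (T x) = x by rewrite {1}/T vT mulrN scaleNr opprK subrK.
exists T; split.
- apply: measurable_rV_add; first exact: measurable_id.
  apply/measurable_rV_opp/measurable_rV_scale => //.
  by apply: measurable_funM => //; apply: measurable_dotp => //; exact: measurable_id.
- by move=> x y; rewrite TB TK.
- move=> x; rewrite /enorm; congr Num.sqrt.
  rewrite /T !(dotpDl, dotpDr, dotpNl, dotpNr, dotpZl, dotpZr) (dotpC x v).
  set q := dotp v x; have -> : c * q * (c * q * dotp v v) = c * q * q * (c * dotp v v) by ring.
  by rewrite cvv; ring.
- move=> x; rewrite dotpDr dotpNr dotpZr.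
  (* Since [e] and [g] have the same length, [c * dotp g v = 1]: reflecting [x] removes exactly
     [dotp v x] from [dotp g x], which leaves [dotp e x]. *)
  have gv : 2 * dotp g v = dotp v v by rewrite vv vE dotpDr dotpNr gg; ring.
  have cgv : c * dotp g v = 1.
    by apply: (@mulfI _ 2) => //; rewrite mulrCA gv cvv mulr1.
  by rewrite mulrAC cgv mul1r vE dotpDl dotpNl; ring.
Qed.

End euclidean_theory.

Section lebesgue_rV_invariance.
Context {R : realType} (n : nat).
Local Notation V := 'rV[R]_n.
Local Notation L := (@lebesgue_rV R n).
Local Open Scope ereal_scope.

(** The transformation identity for the identity map, tested against a cube of measure 1. *)
Lemma lebesgue_rV_opp (A : set V) : measurable A ->
  L (-%R @^-1` A) = L A.
Proof.
move=> mA.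
have : L A * L (box n 0 1) = L (box n 0 1) * L (-%R @^-1` A).
  exact: (@lebesgue_rV_transform _ n idfun idfun A (box n 0 1)
    (@measurable_id _ _ _) (fun _ _ => erefl) mA (measurable_box _ _)).
by rewrite [L (box _ _ _)]lebesgue_rV_box// subr0 expr1n mule1 mul1e.
Qed.

(** The preimage of the unit cube is the cube of side [a^-1], which gives the factor. *)
Lemma lebesgue_rV_scale (a : R) (A : set V) : (0 < a)%R -> measurable A ->
  L ((fun x => a *: x)%R @^-1` A) = ((a^-1) ^+ n)%:E * L A.
Proof.
move=> a0 mA.
have mT : measurable_fun setT (fun x : V => a *: x)%R.
  by apply: measurable_rV_scale => //; exact: measurable_id.
have TS (x y : V) : (a *: (x - a^-1 *: y) = a *: x - y)%R.
  by rewrite scalerBr scalerA divff ?gt_eqF// scale1r.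
have := lebesgue_rV_transform mT TS mA (measurable_box 0 1).
rewrite lebesgue_rV_opp// [L (box _ _ _)]lebesgue_rV_box// subr0 expr1n mule1.
move=> ->; rewrite (_ : _ @^-1` _ = box n 0 a^-1).
  by rewrite [L _]lebesgue_rV_box ?subr0// invr_ge0 ltW.
apply/seteqP; split=> x xB i; have := xB i; rewrite mxE.
  by rewrite pmulr_rge0// -ltr_pdivlMl// mulr1.
by rewrite pmulr_rge0// -ltr_pdivlMl// mulr1.
Qed.

Lemma lebesgue_rV_ball_lty (r : R) : L [set x | enorm x <= r]%R < +oo.
Proof.
have [r0|r0] := ltP r 0%R.
  rewrite (_ : [set _ | _] = set0) ?measure0//; apply/seteqP; split=> x //= xr.
  by have := le_lt_trans xr r0; rewrite ltNge enorm_ge0.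
(* The extra 1 is there because boxes are open on the right. *)
apply: (@le_lt_trans _ _ (L (box n (- r) (r + 1))%R)).
  apply: le_measure; rewrite ?inE.
  - rewrite -[X in measurable X]setTI; apply: measurable_fun_le => //.
    exact: measurable_enorm.
  - exact: measurable_box.
  - move=> x /= xr i; have := le_trans (coord_le_enorm x i) xr.
    by rewrite ler_norml => /andP[-> ?]/=; lra.
by rewrite [L _]lebesgue_rV_box ?ltry//; lra.
Qed.

Lemma lebesgue_rV_ball_gt0 : 0 < L [set x | enorm x <= 1]%R.
Proof.
(* On this box each squared coordinate is at most [1 / (n + 1)], so their sum is at most 1; the side
   is also meaningful for [n = 0]. *)
apply: (@lt_le_trans _ _ (L (box n 0 n.+1%:R^-1))).
  rewrite [L _]lebesgue_rV_box ?invr_ge0// lte_fin exprn_gt0// subr0.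
apply: le_measure; rewrite ?inE.
- exact: measurable_box.
- rewrite -[X in measurable X]setTI; apply: measurable_fun_le => //.
  exact: measurable_enorm.
- move=> x xB /=; rewrite -[leRHS]sqrtr1 ler_sqrt// /dotp.
  apply: (@le_trans _ _ (\sum_(i < n) n.+1%:R^-1)%R).
    apply: ler_sum => i _; have /andP[x0 x1] := xB i.
    rewrite -[leRHS]mulr1; apply: ler_pM => //; first exact: ltW.
    by rewrite (le_trans (ltW x1))// invf_le1// ler1n.
  rewrite sumr_const card_ord -[leLHS]mulr_natl ler_pdivrMr// mul1r ler_nat.
  exact: leqnSn.
Qed.

(** The unit ball is its own preimage under [T]; used as the test set, it contributes the same
    positive finite factor to both sides, and this factor cancels. *)
Lemma lebesgue_rV_isometry (T S : V -> V) (A : set V) :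
  measurable_fun setT T -> (forall x y, T (x - S y) = T x - y)%R ->
  (forall x, enorm (T x) = enorm x) -> measurable A ->
  L (T @^-1` A) = L A.
Proof.
move=> mT TS Tn mA; set B := [set x : V | enorm x <= 1]%R.
have mB : measurable B.
  rewrite -[X in measurable X]setTI; apply: measurable_fun_le => //.
  exact: measurable_enorm.
have := lebesgue_rV_transform mT TS mA mB.
rewrite lebesgue_rV_opp// (_ : T @^-1` B = B); last first.
  by apply/seteqP; split=> x /=; rewrite /B /= Tn.
have LBlty : L B < +oo := lebesgue_rV_ball_lty 1.
have LBfin : L B \is a fin_num by rewrite ge0_fin_numE.
rewrite muleC; apply: (inc_inj (lee_pmul2l LBfin _)).
exact: lebesgue_rV_ball_gt0.
Qed.

End lebesgue_rV_invariance.

(** * Borel sets and C^1 calculus *)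

Section borel_rV.
Context {R : realType} {n : nat}.
Local Notation V := 'rV[R]_n.

(** The sigma-algebra is generated by coordinates, so [U] is written as a countable union of cubes
    with rational centres, keeping only the cubes contained in [U]. *)
Lemma open_measurable_rV (U : set V) : open U -> measurable U.
Proof.
move=> oU.
pose cube (q : 'rV[rat]_n * nat) : set V :=
  [set x | forall i, `|ratr (q.1 ord0 i) - x ord0 i| < q.2.+1%:R^-1].
have mcube q : measurable (cube q).
  rewrite (_ : cube q = \bigcap_(i in [set: 'I_n])
      ((fun x : V => x ord0 i) @^-1` ball (ratr (q.1 ord0 i) : R) q.2.+1%:R^-1)).
    apply: fin_bigcap_measurable => // i _.
    apply: measurable_rV_preimage; first exact: measurable_coord.
    exact: measurable_ball.
  by apply/seteqP; split=> [x xq i _|x xq i]; [exact: xq|exact: (xq i Logic.I)].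
pose F q := if `[< cube q `<=` U >] then cube q else set0.
rewrite (_ : U = \bigcup_q F q).
  apply: countable_bigcupT_measurable; first exact: countableP.
  by move=> q; rewrite /F; case: ifPn.
apply/seteqP; split=> [x Ux|x [q _]]; last first.
  by rewrite /F; case: ifPn => // /asboolP; exact.
have [e /= e0 xeU] : exists2 e : R, 0 < e & ball x e `<=` U.
  by apply/nbhs_ballP; exact: open_nbhs_nbhs.
(* Half of [e], because a point of the cube and [x] are each within [1 / (k + 1)] of the rational
   centre in every coordinate. *)
have [k k_gt] : exists k : nat, k.+1%:R^-1 < e / 2.
  have [k _ /(_ _ (leqnn k))] := near_infty_natSinv_lt (PosNum (divr_gt0 e0 (ltr0n _ 2))).
  by exists k.
have [q qx] : exists q : 'rV[rat]_n, forall i, `|ratr (q ord0 i) - x ord0 i| < k.+1%:R^-1.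
  have /choice[q qx] (i : 'I_n) : exists q : rat, `|ratr q - x ord0 i| < k.+1%:R^-1.
    have : x ord0 i - k.+1%:R^-1 < x ord0 i + k.+1%:R^-1.
      by rewrite ltrD2l gtrN// invr_gt0.
    move=> /rat_in_itvoo[q]; rewrite in_itv/= => /andP[q1 q2].
    by exists q; rewrite ltr_norml ltrBrDl q1 ltrBlDl q2.
  by exists (\row_i q i) => i; rewrite mxE.
exists (q, k) => //; rewrite /F; case: ifPn => [_ //|/asboolPn []].
move=> y yq; apply: xeU; split=> // i j; rewrite (ord1 i : i = ord0) /ball/=.
apply: (@le_lt_trans _ _ (`|ratr (q ord0 j) - y ord0 j| +
  `|ratr (q ord0 j) - x ord0 j|)).
  by rewrite [leRHS]addrC (distrC _ (x _ _)) (le_trans _ (ler_normD _ _))// addrA subrK.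
by rewrite (lt_trans (ltrD (yq j) (qx j)))//= -mulr2n -[ltLHS]mulr_natr -ltr_pdivlMr.
Qed.

Lemma continuous_measurable_rV (u : V -> R) :
  continuous u -> measurable_fun setT u.
Proof.
move=> /continuousP cu; apply: (measurability _ (RGenOpens.measurableE R)).
move=> _ [_ [a [b ->] <-]]; rewrite setTI; apply: open_measurable_rV.
exact/cu/interval_open.
Qed.

End borel_rV.

Section C1_calculus.
Context {R : realType} {n : nat}.
Local Notation V := 'rV[R]_n.
Implicit Types (u : V -> R) (x h t : V).

Lemma line_is_derive u x v (s : R) :
  (forall y, derivable u y v) ->
  is_derive s 1 (fun r : R => u (x + r *: v)) ('D_v u (x + s *: v)).
Proof.
move=> dv.
have E : (fun r : R => r^-1 *: (((fun r : R => u (x + r *: v)) \o shift s) (r *: 1)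
    - u (x + s *: v))) =
  (fun r : R => r^-1 *: ((u \o shift (x + s *: v)) (r *: v) - u (x + s *: v))).
  apply/funext => r /=; congr (_ *: (u _ - _)).
  by rewrite -[r *: 1]/(r * 1) mulr1 scalerDl addrCA.
split; first by have := dv (x + s *: v); rewrite /derivable E.
by rewrite /derive E.
Qed.

Lemma coordinate_MVT u x v (c : R) :
  (forall y, derivable u y v) ->
  exists2 d : R, `|d| <= `|c| & u (x + c *: v) - u x = c * 'D_v u (x + d *: v).
Proof.
move=> dv; pose f r := u (x + r *: v).
have df (s : R) : is_derive s 1 f ('D_v u (x + s *: v)) by exact: line_is_derive.
have cf : continuous f.
  by move=> s; apply/differentiable_continuous/derivable1_diffP; case: (df s).
have f0 : f 0 = u x by rewrite /f scale0r addr0.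
have [c0|c0] := leP 0 c.
  have [d dc fc] := @MVT_segment _ f _ 0 c c0 (fun s _ => df s)
    (continuous_subspaceT cf).
  exists d; last by rewrite -f0 -[u (x + c *: v)]/(f c) fc subr0 mulrC.
  by move: dc; rewrite in_itv/= => /andP[d0 dc]; rewrite !ger0_norm.
have [d dc fc] := @MVT_segment _ f _ c 0 (ltW c0) (fun s _ => df s)
  (continuous_subspaceT cf).
exists d.
  move: dc; rewrite in_itv/= => /andP[d0 dc]; rewrite (ler0_norm dc).
  by rewrite ltr0_norm// lerN2.
by rewrite -f0 -[u (x + c *: v)]/(f c) -opprB fc sub0r; ring.
Qed.

(** Going from [x] to [x + h] one coordinate at a time and telescoping replaces total
    differentiability by one-variable mean values. The intermediate points depend on [i], but each
    is controlled coordinatewise by [h], which suffices for the Lipschitz bound and for the limit of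
    difference quotients. *)
Lemma class_C1_increment u x h : class_C 1 u ->
  exists2 xi : 'I_n -> V, forall i j, `|xi i ord0 j| <= `|h ord0 j| &
    u (x + h) - u x = \sum_i h ord0 i * 'D_(basis_rV i) u (x + xi i).
Proof.
case=> _ C1.
pose hk k : V := \row_j (if (j < k)%N then h ord0 j else 0).
have hkS (i : 'I_n) : hk i.+1 = hk i + h ord0 i *: basis_rV i.
  apply/rowP => j; rewrite /basis_rV !mxE/= ltnS leq_eqVlt -val_eqE /=.
  have [/val_inj->|ji] /= := eqVneq (val j) (val i); first by rewrite ltnn mulr1 add0r.
  by rewrite mulr0 addr0.
have hi (i : 'I_n) : exists y : V, (forall j, `|y ord0 j| <= `|h ord0 j|) /\
    u (x + hk i.+1) - u (x + hk i) = h ord0 i * 'D_(basis_rV i) u (x + y).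
  have [d dh uE] := coordinate_MVT (x + hk i) (h ord0 i) (C1 i).1.
  exists (hk i + d *: basis_rV i); split; last by rewrite hkS !addrA.
  move=> j; rewrite /basis_rV !mxE/= -val_eqE /=.
  have [/val_inj->|ji] /= := eqVneq (val j) (val i); first by rewrite ltnn mulr1 add0r.
  by rewrite mulr0 addr0; case: ifP => // _; rewrite normr0.
have [xi xiP] := choice hi.
exists xi; first by move=> i; exact: (xiP i).1.
under eq_bigr => i _ do rewrite -(xiP i).2.
rewrite -(big_mkord xpredT (fun k => u (x + hk k.+1) - u (x + hk k))).
rewrite telescope_sumr//; congr (u _ - u _).
  by congr (_ + _); apply/rowP => j; rewrite mxE ltn_ord.
by rewrite (_ : hk 0%N = 0) ?addr0//; apply/rowP => j; rewrite !mxE.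
Qed.

Lemma class_C1_lipschitz u (M : R) : class_C 1 u ->
  (forall i x, `|'D_(basis_rV i) u x| <= M) ->
  forall x h, `|u (x + h) - u x| <= (n%:R * M) * enorm h.
Proof.
move=> C1 DM x h; have [xi _ ->] := class_C1_increment x h C1.
rewrite (le_trans (ler_norm_sum _ _ _))//.
rewrite (@le_trans _ _ (\sum_(i < n) (M * enorm h)))//.
  apply: ler_sum => i _; rewrite normrM mulrC ler_pM//.
  exact: coord_le_enorm.
by rewrite sumr_const card_ord -mulrA mulr_natl.
Qed.

(** In the increment formula with [h = eps k *: t] the partial derivatives are evaluated at points
    tending to [x], and they are continuous. *)
Lemma class_C1_directional_cvg u x t (eps : R^nat) : class_C 1 u ->
  (forall k, 0 < eps k) -> eps @ \oo --> (0 : R) ->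
  (u (x + eps k *: t) - u x) / eps k @[k --> \oo] --> dotp (grad u x) t.
Proof.
move=> C1 eps0 epscvg.
have /choice[xi xiP] k : exists xi : 'I_n -> V,
    (forall i j, `|xi i ord0 j| <= eps k * `|t ord0 j|) /\
    (u (x + eps k *: t) - u x) / eps k =
      \sum_i 'D_(basis_rV i) u (x + xi i) * t ord0 i.
  have [xi xih ->] := class_C1_increment x (eps k *: t) C1.
  exists xi; split.
    by move=> i j; rewrite (le_trans (xih i j))// mxE normrM gtr0_norm.
  rewrite mulr_suml; apply: eq_bigr => i _; rewrite mxE.
  by rewrite mulrAC [X in X * _]mulrAC mulfV ?gt_eqF// mul1r mulrC.
rewrite (eq_cvg _ _ (fun k => (xiP k).2)) /dotp.
apply: cvg_big => [|i _]; first exact: add_continuous.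
rewrite mxE; apply: cvgM; last exact: cvg_cst.
have cD : {for x, continuous ('D_(basis_rV i) u)} by case: C1 => _ /(_ i)[_]; exact.
suff cx : (x + xi k i) @[k --> \oo] --> x by exact: (cvg_comp _ _ cx cD).
apply/cvg_ballP => e e0.
(* Adding 1 keeps the denominator positive when [t = 0]. *)
have /cvgr0Pnorm_lt/(_ (e / (enorm t + 1))) := epscvg.
rewrite divr_gt0//; last by rewrite ltr_wpDl// enorm_ge0.
move=> /(_ isT); apply: filterS => k.
rewrite gtr0_norm// ltr_pdivlMr => [ke|]; last by rewrite ltr_wpDl// enorm_ge0.
split=> // a j; rewrite (ord1 a : a = ord0) mxE /ball/= opprD addNKr normrN.
apply: le_lt_trans ke; rewrite (le_trans ((xiP k).1 i j))// ler_pM2l//.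
by rewrite (le_trans (coord_le_enorm t j))// lerDl.
Qed.

Lemma compactly_supported_bounded u : compactly_supported u ->
  exists r : R, forall x, u x != 0 -> forall i, `|x ord0 i| <= r.
Proof.
move=> /compact_bounded[M [_ MP]]; exists (M + 1) => x ux i.
have Kx : closure [set x | u x != 0] x by exact: subset_closure.
have := MP (M + 1) (ltr_pwDr ltr01 (lexx M)) x Kx.
by apply: le_trans; rewrite [leRHS]/Num.norm/= mx_normrE; apply/bigmax_geP;
  right => /=; exists (ord0, i).
Qed.

Lemma compactly_supported_partial_bounded u : class_C 1 u ->
  compactly_supported u ->
  exists2 M : R, 0 <= M & forall i x, `|'D_(basis_rV i) u x| <= M.
Proof.
move=> [cu C1]; rewrite /compactly_supported; set K := closure _ => cK.
have Kbd i : exists M : R, forall x, K x -> `|'D_(basis_rV i) u x| <= M.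
  have cD : {within K, continuous ('D_(basis_rV i) u)}.
    by apply: continuous_subspaceT => x; case: (C1 i) => _; exact.
  have /compact_bounded[M [_ MP]] := continuous_compact cD cK.
  exists (M + 1) => x Kx; apply: (MP (M + 1)); first by rewrite ltr_pwDr.
  by exists x.
have [M MP] := choice Kbd.
exists (\sum_i `|M i|); first exact: sumr_ge0.
move=> i x; have [Kx|nKx] := pselect (K x).
  rewrite (le_trans (MP i x Kx))// (le_trans (ler_norm _))//.
  by rewrite (bigD1 i)//= lerDl sumr_ge0.
(* Off its closed support [u] vanishes in a neighbourhood of [x], so its derivative there is that of
   a constant. *)
rewrite (@near_eq_derive _ _ _ u (cst 0)) ?derive_cst ?normr0 ?sumr_ge0//.
have : nbhs x (~` K) by apply: open_nbhs_nbhs; split => //; exact/closed_openC/closed_closure.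
apply: filterS => y nKy; apply/eqP; apply: contrapT => /negP uy.
by apply: nKy; exact: subset_closure.
Qed.

End C1_calculus.

(** * Polar coordinates *)

Section polar.
Context {R : realType}.
Local Open Scope ereal_scope.

Lemma measurable_le_set d (T : measurableType d) (f g : T -> R) :
  measurable_fun setT f -> measurable_fun setT g ->
  measurable [set x | f x <= g x]%R.
Proof.
by move=> mf mg; rewrite -[X in measurable X]setTI; exact: measurable_fun_le.
Qed.

Lemma measurable_lt_set d (T : measurableType d) (f g : T -> R) :
  measurable_fun setT f -> measurable_fun setT g ->
  measurable [set x | f x < g x]%R.
Proof.
move=> mf mg; rewrite (_ : [set _ | _] = ~` [set x | g x <= f x]%R).
  by apply: measurableC; exact: measurable_le_set.
by apply/seteqP; split=> x /=; [rewrite ltNge => /negP|move=> /negP; rewrite -ltNge].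
Qed.

Lemma integral_indicM d (T : measurableType d)
    (m : {measure set T -> \bar R}) (D : set T) (f : T -> R) :
  \int[m]_x (f x * \1_D x)%:E = \int[m]_(x in D) (f x)%:E.
Proof.
rewrite [RHS]integral_mkcond; apply: eq_integral => x _.
by rewrite patchE indicE; case: ifPn => _; rewrite ?mulr1 ?mulr0.
Qed.

Lemma eq_indic_iff T1 T2 (A : set T1) (B : set T2) x y : (A x <-> B y) ->
  \1_A x = \1_B y :> R.
Proof.
by move=> AB; rewrite !indicE; congr (_ : bool)%:R; apply/idP/idP; rewrite !inE => /AB.
Qed.

Lemma ysectionE T1 T2 (A : set (T1 * T2)) y : ysection A y = [set x | A (x, y)].
Proof. by apply/seteqP; split=> x; rewrite /ysection/= inE. Qed.

(** In the polar argument the [t]-slices are intervals of explicit weighted length, while dilations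
    act on the [s]-slices; this lemma passes between the two. *)
Lemma tonelli_weight n (w : R -> R) (X : set ('rV[R]_n * measurableTypeR R)) :
  measurable_fun setT w -> (forall s, 0 <= w s)%R -> measurable X ->
  \int[lebesgue_rV n]_t \int[lebesgue_measure]_s (w s * \1_X (t, s))%:E =
  \int[lebesgue_measure]_s ((w s)%:E * lebesgue_rV n (ysection X s)).
Proof.
move=> mw w0 mX.
pose L : {sigma_finite_measure set 'rV[R]_n -> \bar R} := @lebesgue_rV R n.
pose l : {sigma_finite_measure set (measurableTypeR R) -> \bar R} :=
  @lebesgue_measure R.
pose f (z : 'rV[R]_n * measurableTypeR R) := (w z.2 * \1_X z)%:E.
have mf : measurable_fun setT f.
  apply/measurable_EFinP/measurable_funM; last exact: measurable_indic.
  exact: (measurableT_comp mw measurable_snd).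
have f0 z : 0 <= f z by rewrite lee_fin mulr_ge0.
transitivity (\int[l]_s fubini_G L f s).
  by rewrite -(@fubini_tonelli _ _ _ _ _ L l f).
apply: eq_integral => s _; rewrite /fubini_G /f /=.
under eq_integral do rewrite EFinM.
rewrite ge0_integralZl//; last 2 first.
- apply/measurable_EFinP.
  by apply: (measurableT_comp (measurable_indic mX)); exact: measurable_pair2.
- by rewrite lee_fin.
congr (_ * _); transitivity (\int[L]_t (\1_(ysection X s) t)%:E).
  by apply: eq_integral => t _; rewrite !indicE mem_ysection.
rewrite integral_indic ?setIT//; exact: measurable_ysection.
Qed.

Lemma integral_inv (a b : R) : (0 < a <= b)%R ->
  \int[lebesgue_measure]_(s in `[a, b]) (s `^ (-1))%:E = (ln b - ln a)%:E.
Proof.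
move=> /andP[a0]; rewrite le_eqVlt => /predU1P[<-|ab].
  by rewrite subrr set_itv1 integral_set1.
rewrite (@continuous_FTC2 _ (fun s => s `^ (-1))%R (@ln R) a b ab) -?EFinB//.
- apply: derivable_within_continuous => s; rewrite in_itv/= => /andP[sa _].
  by apply: derivable_powR; rewrite in_itv/= andbT; exact: lt_le_trans a0 sa.
- split.
  + move=> s; rewrite in_itv/= => /andP[sa _].
    by apply: ex_derive; exact/is_derive1_ln/(lt_trans a0).
  + by apply: cvg_at_right_filter; exact: continuous_ln.
  + by apply: cvg_at_left_filter; apply: continuous_ln; exact: lt_trans ab.
- move=> s; rewrite in_itv/= => /andP[sa _].
  have s0 := lt_trans a0 sa.
  by rewrite derive1E powR_inv1 ?ltW//; have [_ ->] := is_derive1_ln s0.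
Qed.


(** The exponent [1 / n] makes the Jacobian of the dilation equal to [s], so that its inverse is the
    weight [ds / s]. *)
Lemma lebesgue_rV_scale_root n (s : R) (A : set 'rV[R]_n) :
  (0 < n)%N -> (0 < s)%R -> measurable A ->
  lebesgue_rV n ((fun t => s `^ n%:R^-1 *: t)%R @^-1` A) =
  (s `^ (-1))%:E * lebesgue_rV n A.
Proof.
move=> n0 s0 mA; rewrite lebesgue_rV_scale ?powR_gt0//; congr (_%:E * _).
rewrite exprVn -powR_mulrn ?powR_ge0// -powRrM mulVf ?pnatr_eq0 -?lt0n//.
by rewrite powRr1 ?ltW// powR_inv1 ?ltW.
Qed.

(* Multiplying t by s^(1/n) multiplies |t|^n by s, so both sides are the integral
   of L{t | t <> 0, |t|^n <= s <= h t} against ds/s, which is invariant under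
   dilations. *)
Lemma lebesgue_rV_polar n (h : 'rV[R]_n -> R) : (0 < n)%N ->
  measurable_fun setT h -> (forall t, 0 <= h t <= 1)%R ->
  (forall c t, 0 < c -> h (c *: t) = h t)%R ->
  \int[lebesgue_rV n]_(t in [set t | (0 < enorm t <= 1)%R]) (h t)%:E =
  lebesgue_rV n [set t | t <> 0%R /\ (enorm t ^+ n <= h t)%R].
Proof.
move=> n0 mh h01 hZ.
have h_ge0 t : (0 <= h t)%R by have /andP[] := h01 t.
pose L := @lebesgue_rV R n; pose l := @lebesgue_measure R.
(* It equals [1 / s] for [s > 0] and, unlike the inverse, is nonnegative on the whole line, as
   [tonelli_weight] demands. *)
pose w (s : R) := (s `^ (-1))%R.
have w0 s : (0 <= w s)%R by exact: powR_ge0.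
have mw : measurable_fun setT w by exact: measurable_powR.
pose V := 'rV[R]_n; pose T := (V * measurableTypeR R)%type.
have m1 : measurable_fun setT (fun z : T => enorm z.1).
  exact: measurable_enorm_comp measurable_fst.
have m1n : measurable_fun setT (fun z : T => enorm z.1 ^+ n)%R.
  exact: measurable_funX.
have mh1 : measurable_fun setT (fun z : T => h z.1).
  exact: (measurableT_comp mh measurable_fst).
have m2 : measurable_fun setT (fun z : T => z.2 : R) by exact: measurable_snd.
pose pos := [set z : T | 0 < enorm z.1]%R `&` [set z | 0 < z.2]%R.
(* [A] carries the left side: over the punctured ball its [t]-slices have length [h t]. [C] carries
   the right side: for [0 < s <= 1] its [s]-slices are dilates of [F]. [B] links them: its
   [s]-slices are dilates of those of [A], and its [t]-slices have the same [ds / s]-length as those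
   of [C]. *)
pose A : set T := pos `&` ([set z | enorm z.1 <= 1]%R `&` [set z | z.2 <= h z.1]%R).
pose B : set T := pos `&` ([set z | enorm z.1 ^+ n <= z.2]%R `&` [set z | z.2 <= h z.1]%R).
pose C : set T := pos `&`
  ([set z | z.2 <= 1]%R `&` [set z | enorm z.1 ^+ n <= z.2 * h z.1]%R).
pose F := [set t : V | t <> 0%R /\ (enorm t ^+ n <= h t)%R].
have mpos : measurable pos by apply: measurableI; exact: measurable_lt_set.
have mA : measurable A.
  by do 2 (apply: measurableI => //); exact: measurable_le_set.
have mB : measurable B.
  by do 2 (apply: measurableI => //); exact: measurable_le_set.
have mC : measurable C.
  do 2 (apply: measurableI => //); apply: measurable_le_set => //.
  exact: measurable_funM.
have mF : measurable F.
  rewrite (_ : F = [set t | 0 < enorm t]%R `&` [set t | enorm t ^+ n <= h t]%R).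
    apply: measurableI; [apply: measurable_lt_set|apply: measurable_le_set] => //.
      exact: measurable_enorm.
    by apply: measurable_funX; exact: measurable_enorm.
  by apply/seteqP; split=> t [/enorm_gt0P].
have sK (s : R) : (0 < s -> (s `^ n%:R^-1) ^+ n = s)%R.
  move=> s0; rewrite -powR_mulrn ?powR_ge0// -powRrM mulVf ?pnatr_eq0 -?lt0n//.
  by rewrite powRr1 ?ltW.
have eZ (s : R) (t : V) : (0 < s -> enorm (s `^ n%:R^-1 *: t) ^+ n = s * enorm t ^+ n)%R.
  by move=> s0; rewrite enormZ exprMn ger0_norm ?powR_ge0// sK.
have eZ0 (s : R) (t : V) : (0 < s -> (0 < enorm (s `^ n%:R^-1 *: t)) = (0 < enorm t))%R.
  by move=> s0; rewrite enormZ gtr0_norm ?powR_gt0// pmulr_rgt0// powR_gt0.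
have ysect0 (X : set T) s : (s <= 0)%R -> X `<=` pos -> ysection X s = set0.
  move=> s0 Xpos; rewrite ysectionE -subset0 => t /Xpos[_ /=].
  by rewrite ltNge s0.
transitivity (\int[L]_t \int[l]_s (1 * \1_A (t, s))%:E).
  rewrite integral_mkcond; apply: eq_integral => t _; rewrite patchE.
  case: ifPn => [|/negP tD]; last first.
    rewrite integral0_eq// => s _; rewrite indicE memNset ?mulr0//.
    by case=> -[/= t0 _] [/= t1 _]; apply: tD; rewrite inE /= t0.
  rewrite inE/= => /andP[t0 t1].
  transitivity (\int[l]_s (1 * \1_(`]0%R, h t]%classic) s)%:E); last first.
    apply: eq_integral => s _; congr (_ * _)%:E; apply: eq_indic_iff.
    by rewrite /A /pos/= in_itv/=; split=> [/andP[]|[[_ ->] [_ ->]]].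
  rewrite integral_indicM integral_cst// mul1e /= lebesgue_measure_itv/= lte_fin.
  by have := h_ge0 t; rewrite le_eqVlt => /predU1P[<-|->]; rewrite ?ltxx// oppr0 adde0.
rewrite [LHS](@tonelli_weight n (cst 1%R) A)//.
transitivity (\int[l]_s ((w s)%:E * L (ysection B s))).
  apply: eq_integral => s _; rewrite mul1e.
  have [s0|s0] := ltP 0%R s; last first.
    rewrite (ysect0 A s s0 (@subIsetl _ _ _)) (ysect0 B s s0 (@subIsetl _ _ _)).
    by rewrite /L measure0 mule0.
  rewrite /L -lebesgue_rV_scale_root//; last exact: measurable_ysection.
  congr (lebesgue_rV n _); rewrite !ysectionE; apply/seteqP; split=> t;
    rewrite /A /B /pos /= eZ0// eZ// hZ ?powR_gt0//
      ger_pMr// expr_le1 ?enorm_ge0//.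
rewrite -(@tonelli_weight n w B)//.
(* With [a = |t|^n] and [b = h t], the slices are [[a, b]] and [[a / b, 1]], both of [ds / s]-length
   [ln b - ln a], and both are empty when [b < a]. *)
transitivity (\int[L]_t \int[l]_s (w s * \1_C (t, s))%:E).
  apply: eq_integral => t _.
  have [t0|t0] := ltP 0%R (enorm t); last first.
    rewrite !integral0_eq// => s _; rewrite indicE memNset ?mulr0//;
      by case=> -[/=]; rewrite ltNge t0.
  set a := (enorm t ^+ n)%R; set b := h t.
  have a0 : (0 < a)%R by rewrite exprn_gt0.
  have [ab|ba] := leP a b; last first.
    rewrite !integral0_eq// => s _; rewrite indicE memNset ?mulr0//.
      by case=> -[/= _ s0] [/= s1]; rewrite leNgt (le_lt_trans _ ba)// ler_piMl.
    by case=> _ [/= /le_trans h1] /h1; rewrite leNgt ba.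
  have b0 : (0 < b)%R by exact: lt_le_trans ab.
  transitivity (\int[l]_s (w s * \1_(`[a, b]%classic) s)%:E).
    apply: eq_integral => s _; congr (_ * _)%:E; apply: eq_indic_iff.
    rewrite /B /pos/= in_itv/=; split=> [[_ [-> ->]]//|/andP[sa ->]].
    by split=> //; split => //; exact: lt_le_trans sa.
  transitivity (\int[l]_s (w s * \1_(`[(a / b)%R, 1%R]%classic) s)%:E); last first.
    apply: eq_integral => s _; congr (_ * _)%:E; apply: eq_indic_iff.
    rewrite /C /pos/= in_itv/= ler_pdivrMr//.
    split=> [/andP[sa ->]|[_ [-> ->]]//].
    by split=> //; split => //; rewrite -(pmulr_lgt0 _ b0); exact: lt_le_trans sa.
  rewrite !integral_indicM !integral_inv//; first last.
  - by rewrite a0.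
  - by rewrite divr_gt0// ler_pdivrMr// mul1r.
  - by rewrite ln1 ln_div// sub0r opprB.
rewrite (@tonelli_weight n w C)//.
transitivity (\int[l]_s ((\1_(`]0%R, 1%R]%classic) s)%:E * L F)).
  apply: eq_integral => s _; rewrite indicE.
  have [/set_mem/=|/negP s01] := boolP (s \in _).
    rewrite in_itv/= => /andP[s0 s1]; rewrite mul1e /L.
    rewrite -lebesgue_rV_scale_root//; last exact: measurable_ysection.
    congr (lebesgue_rV n _); rewrite !ysectionE; apply/seteqP; split=> t;
      rewrite /C /F /pos /= eZ0// eZ// hZ ?powR_gt0// ler_pM2l// enorm_gt0P.
      by case=> -[t0 _] [].
    by case=> t0 th; split.
  rewrite mul0e (_ : ysection C s = set0) /L ?measure0 ?mule0//.
  rewrite ysectionE -subset0 => t [[_ /= s0] [/= s1 _]].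
  by apply: s01; rewrite inE /= in_itv/= s0.
rewrite ge0_integralZr//; last exact/measurable_EFinP/measurable_indic.
by rewrite integral_indic// setIT /= lebesgue_measure_itv/= lte_fin ltr01 oppr0 adde0 mul1e.
Qed.

End polar.

(** * The limiting region *)

Section difference_quotient_region.
Context {R : realType} {n : nat}.
Variable p : R.
Hypotheses (n0 : (0 < n)%N) (p1 : 1 <= p).
Local Notation V := 'rV[R]_n.
Local Notation L := (@lebesgue_rV R n).
Implicit Types (g t e : V).

Let p0 : 0 < p.
Proof. exact: lt_le_trans p1. Qed.

Definition quotient_region g : set V :=
  [set t | t <> 0 /\ enorm t `^ (n%:R / p + 1) <= `|dotp g t|].

(** The integrand of [k_const], extended from the sphere as a function homogeneous of degree 0. *)
Let dirpow g t : R := `|dotp g ((enorm t)^-1 *: t)| `^ p.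

Let dirpowZ g (c : R) t : 0 < c -> dirpow g (c *: t) = dirpow g t.
Proof.
move=> c0; rewrite /dirpow enormZ (gtr0_norm c0) scalerA.
by rewrite invfM mulrAC mulVf ?mul1r// gt_eqF.
Qed.

Let measurable_dirpow g : measurable_fun setT (dirpow g).
Proof.
apply: (measurableT_comp (measurable_powR _)); apply: measurableT_comp => //.
by apply: measurable_dotp => //; exact: measurable_normalize.
Qed.

(** Dividing the defining inequality by [|t|] and raising it to the power [p] separates radius from
    direction, which is the form needed for [lebesgue_rV_polar]. *)
Let quotient_regionE g :
  quotient_region g = [set t | t <> 0 /\ enorm t ^+ n <= dirpow g t].
Proof.
apply/seteqP; rewrite /quotient_region; split=> t /= [t0 tg]; split=> //;
  move: tg; have r0 := enorm_gt0 t0;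
  have rE : enorm t `^ (n%:R / p + 1) = enorm t `^ (n%:R / p) * enorm t
    by rewrite powRD ?powRr1 ?(gt_eqF r0) ?implybT// ltW.
  all: have q0 : 0 <= `|dotp g t| / enorm t by rewrite divr_ge0// ltW.
  all: have dE : dirpow g t = (`|dotp g t| / enorm t) `^ p
    by rewrite /dirpow dotpZr normrM (gtr0_norm (x := _^-1)) ?invr_gt0// mulrC.
- rewrite rE -ler_pdivlMr// dE => tg.
  have -> : enorm t ^+ n = (enorm t `^ (n%:R / p)) `^ p.
    by rewrite -powRrM divfK ?gt_eqF// powR_mulrn// ltW.
  by apply: ge0_ler_powR; rewrite ?nnegrE ?powR_ge0 ?q0// ltW.
- rewrite rE -ler_pdivlMr// dE => tg.
  have -> : enorm t `^ (n%:R / p) = (enorm t ^+ n) `^ p^-1.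
    by rewrite powRrM powR_mulrn// ltW.
  rewrite -[leRHS](_ : (`|dotp g t| / enorm t) `^ p `^ p^-1 = _); last first.
    by rewrite -powRrM divff ?gt_eqF// powRr1.
  by apply: ge0_ler_powR; rewrite ?nnegrE ?invr_ge0 ?exprn_ge0 ?powR_ge0// ltW.
Qed.

Lemma measurable_quotient_region g : measurable (quotient_region g).
Proof.
rewrite quotient_regionE (_ : [set _ | _] =
  [set t | 0 < enorm t] `&` [set t | enorm t ^+ n <= dirpow g t]).
  apply: measurableI; [apply: measurable_lt_set|apply: measurable_le_set] => //.
    exact: measurable_enorm.
  by apply: measurable_funX; exact: measurable_enorm.
by apply/seteqP; split=> t [/enorm_gt0P].
Qed.

(** The dilation by [c^(p/n)] multiplies [|t|^n] by [c^p] and keeps directions, so it carries the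
    region of [g] onto that of [c *: g], with Jacobian [c^p]. *)
Lemma lebesgue_quotient_regionZ (c : R) g : 0 < c ->
  L (quotient_region (c *: g)) = ((c `^ p)%:E * L (quotient_region g))%E.
Proof.
move=> c0; have s0 : 0 < c `^ p by rewrite powR_gt0.
have := lebesgue_rV_scale_root n0 s0 (measurable_quotient_region (c *: g)).
rewrite powR_inv1 ?ltW//.
rewrite (_ : _ @^-1` _ = quotient_region g) => [->|].
  by rewrite muleA -EFinM mulfV ?gt_eqF// mul1e.
have u0 : 0 < (c `^ p) `^ n%:R^-1 by rewrite powR_gt0.
have uK : ((c `^ p) `^ n%:R^-1) ^+ n = c `^ p.
  rewrite -powR_mulrn ?powR_ge0// -[X in X = _]powRrM mulVf ?pnatr_eq0 -?lt0n//.
  by rewrite powRr1// powR_ge0.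
have cE t : dirpow (c *: g) t = c `^ p * dirpow g t.
  by rewrite /dirpow dotpZl normrM (gtr0_norm c0) powRM// ltW.
rewrite !quotient_regionE; apply/seteqP; split=> t /=;
  by rewrite !enorm_gt0P dirpowZ// cE enormZ (gtr0_norm u0) pmulr_rgt0// exprMn uK ler_pM2l.
Qed.

Lemma quotient_region0 : quotient_region 0 = set0.
Proof.
rewrite -subset0 => t [/enorm_gt0 t0].
by rewrite -(scale0r 0) dotpZl mul0r normr0 leNgt powR_gt0.
Qed.

Lemma lebesgue_quotient_region_rot e g : enorm e = 1 -> enorm g = 1 ->
  L (quotient_region g) = L (quotient_region e).
Proof.
move=> e1 g1; have [T [mT TB Tn Tdotp]] := exists_reflection e1 g1.
rewrite -(lebesgue_rV_isometry mT TB Tn (measurable_quotient_region g)).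
congr (lebesgue_rV n _); apply/seteqP; split=> t;
  by rewrite /quotient_region/= Tdotp Tn !enorm_gt0P Tn.
Qed.

Lemma lebesgue_quotient_regionE e g : enorm e = 1 ->
  L (quotient_region g) = ((enorm g `^ p)%:E * L (quotient_region e))%E.
Proof.
move=> e1; have [->|/eqP g0] := eqVneq g 0.
  by rewrite quotient_region0 measure0 enorm0 powR0 ?gt_eqF// mul0e.
rewrite -{1}(_ : enorm g *: ((enorm g)^-1 *: g) = g); last first.
  by rewrite scalerA divff ?scale1r// gt_eqF// enorm_gt0.
rewrite lebesgue_quotient_regionZ ?enorm_gt0//; congr (_ * _)%E.
exact/lebesgue_quotient_region_rot/enorm_normalize.
Qed.

(** By Cauchy-Schwarz [dirpow e t] is at most 1, so the region lies in the unit ball. *)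
Lemma lebesgue_quotient_region_unit_lty e : enorm e = 1 ->
  (L (quotient_region e) < +oo)%E.
Proof.
move=> e1; apply: (le_lt_trans _ (@lebesgue_rV_ball_lty R n 1)).
apply: le_measure; rewrite ?inE.
- exact: measurable_quotient_region.
- by apply: measurable_le_set => //; exact: measurable_enorm.
- move=> t; rewrite quotient_regionE => -[/= t0 tg].
  rewrite -(@expr_le1 _ n)// ?enorm_ge0//; apply: (le_trans tg).
  rewrite /dirpow -[leRHS](_ : 1 `^ p = 1); last (by rewrite powR1); apply: ge0_ler_powR => //.
  + exact: ltW.
  + by rewrite nnegrE.
  + by rewrite (le_trans (dotp_unit_le _ e1))// enorm_normalize.
Qed.

Lemma lebesgue_quotient_region_lty g : unit_sphere R n !=set0 -> 
  (L (quotient_region g) < +oo)%E.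
Proof.
case=> e e1; rewrite (lebesgue_quotient_regionE g e1).
by rewrite lte_mul_pinfty ?lee_fin ?powR_ge0// lebesgue_quotient_region_unit_lty.
Qed.

(** The exceptional set of the convergence in [t]: elsewhere the comparison is strict, or [t = 0],
    and membership is eventually constant. *)
Definition quotient_boundary g : set V :=
  [set t | t <> 0 /\ enorm t `^ (n%:R / p + 1) = `|dotp g t|].

Lemma measurable_quotient_boundary g : measurable (quotient_boundary g).
Proof.
rewrite (_ : quotient_boundary g = quotient_region g `&`
    [set t | `|dotp g t| <= enorm t `^ (n%:R / p + 1)]).
  apply: measurableI; first exact: measurable_quotient_region.
  apply: measurable_le_set.
    by apply: measurableT_comp => //; apply: measurable_dotp => //; exact: measurable_id.
  by apply: (measurableT_comp (measurable_powR _)); exact: measurable_enorm.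
apply/seteqP; split=> t; first by move=> [t0 tE]; split; [split|]; rewrite /= ?tE.
by move=> [[t0 t1] /= t2]; split=> //; apply/eqP; rewrite eq_le t1.
Qed.

(* Removing from the region of g the one of c g, for c < 1 arbitrarily close to 1,
   leaves a set of small measure that still contains the boundary. *)
Lemma lebesgue_quotient_boundary g : unit_sphere R n !=set0 ->
  L (quotient_boundary g) = 0%E.
Proof.
move=> S0; set Z := quotient_boundary g.
have mZ : measurable Z by exact: measurable_quotient_boundary.
have Vlty := lebesgue_quotient_region_lty g S0.
have [v vE] : exists v, L (quotient_region g) = v%:E.
  by exists (fine (L (quotient_region g))); rewrite fineK// ge0_fin_numE.
have ZV : Z `<=` quotient_region g by move=> t [t0 tE]; split; rewrite ?tE.
have [z zE] : exists z, L Z = z%:E.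
  exists (fine (L Z)); rewrite fineK// ge0_fin_numE//.
  apply: le_lt_trans Vlty; apply: le_measure; rewrite ?inE//.
  exact: measurable_quotient_region.
have v0 : 0 <= v by rewrite -lee_fin -vE.
have z0 : 0 <= z by rewrite -lee_fin -zE.
have zv d : 0 < d < 1 -> z <= d * v.
  (* With this [c] the region of [c *: g] has measure [(1 - d) * v], which leaves at most [d * v]
     for the disjoint set [Z]. *)
  move=> /andP[d0 d1]; pose c := (1 - d) `^ p^-1.
  have d1' : 0 < 1 - d by lra.
  have c0 : 0 < c by rewrite powR_gt0.
  have c1 : c < 1.
    rewrite -[ltRHS](_ : 1 `^ p^-1 = 1); last (by rewrite powR1).
    by apply: gt0_ltr_powR; rewrite ?invr_gt0 ?nnegrE//; lra.
  have cp : c `^ p = 1 - d by rewrite -powRrM mulVf ?gt_eqF// powRr1// ltW.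
  have := lebesgue_quotient_regionZ g c0; rewrite cp vE -EFinM => cE.
  have dj : Z `&` quotient_region (c *: g) = set0.
    rewrite -subset0 => t [[t0 tE] [_]].
    have : 0 < `|dotp g t| by rewrite -tE powR_gt0// enorm_gt0.
    by rewrite dotpZl normrM (gtr0_norm c0) tE => h; rewrite leNgt gtr_pMl// c1.
  have : (L (Z `|` quotient_region (c *: g)) <= L (quotient_region g))%E.
    apply: le_measure; rewrite ?inE.
    - by apply: measurableU => //; exact: measurable_quotient_region.
    - exact: measurable_quotient_region.
    - move=> t [/ZV//|[t0]]; rewrite dotpZl normrM (gtr0_norm c0) => h.
      by split=> //; rewrite (le_trans h)// ler_piMl// ltW.
  rewrite measureU//; last exact: measurable_quotient_region.
  by rewrite /= cE vE zE -EFinD lee_fin; lra.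
rewrite zE; congr EFin; apply/eqP; rewrite eq_le z0 andbT leNgt; apply/negP => zp.
(* The choice [d = 1/2] shows that [v > 0] and [z < 2 * v]. This makes [d = z / (2 * v)] admissible,
   and it gives [z <= z / 2]. *)
have zv2 : z <= 2^-1 * v by apply: zv; rewrite invr_gt0 ltr0n invf_lt1// ltr1n.
have vp : 0 < v by rewrite -(pmulr_rgt0 v (_ : 0 < 2^-1))// (lt_le_trans zp).
have : z <= z / (2 * v) * v.
  apply: zv; rewrite divr_gt0 ?mulr_gt0//= ltr_pdivrMr ?mulr_gt0// mul1r.
  by rewrite (le_lt_trans zv2)// ltr_pM2r// (lt_trans (y := 1)) ?invf_lt1 ?ltr1n.
by rewrite invfM mulrA divfK ?gt_eqF// leNgt gtr_pMr// invf_lt1// ltr1n.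
Qed.

(** The surface measure is [n] times the image of Lebesgue measure on the punctured unit ball under
    radial projection, so [k_const] becomes an integral of [dirpow e] over that ball, which
    [lebesgue_rV_polar] evaluates. *)
Lemma k_constE e : enorm e = 1 ->
  k_const p e = (n%:R%:E * L (quotient_region e))%E.
Proof.
move=> e1; rewrite quotient_regionE -lebesgue_rV_polar//; last 2 first.
- move=> t; rewrite powR_ge0/= /dirpow -[leRHS](_ : 1 `^ p = 1); last (by rewrite powR1).
  apply: ge0_ler_powR; rewrite ?nnegrE//; first exact: ltW.
  rewrite (le_trans (dotp_unit_le _ e1))// enormZ.
  have [->|/eqP t0] := eqVneq t 0; first by rewrite enorm0 mulr0.
  by rewrite -enormZ enorm_normalize.
- by move=> c t; exact: dirpowZ.
pose B : set V := [set t | 0 < enorm t <= 1].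
have mB : measurable B.
  rewrite (_ : B = [set t | 0 < enorm t] `&` [set t | enorm t <= 1]).
    apply: measurableI; [apply: measurable_lt_set|apply: measurable_le_set] => //;
    exact: measurable_enorm.
  by apply/seteqP; rewrite /B; split=> t /=; [move/andP|move=> [-> ->]].
(* Radial projection made total: points outside [B] go to 0, which is off the sphere, so they do not
   contribute. *)
pose nu (t : V) : V := \1_B t *: ((enorm t)^-1 *: t).
have mnu : measurable_fun setT nu.
  apply: measurable_rV_scale; last exact: measurable_normalize.
  exact: measurable_indic.
have nuB t : B t -> nu t = (enorm t)^-1 *: t.
  by move=> Bt; rewrite /nu indicE mem_set// scale1r.
have nuN t : ~ B t -> nu t = 0 by move=> Bt; rewrite /nu indicE memNset// scale0r.
pose m : {measure set V -> \bar R} :=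
  measure_function_pushforward__canonical__measure_function_Measure L mnu.
rewrite /k_const (eq_measure_integral (mscale (n%:R%:nng) m)); last first.
  move=> A mA AS; rewrite /mscale /= /surface_measure /m /= /pushforward.
  congr (_ * lebesgue_rV n _)%E; apply/seteqP; split=> t /=.
    by move=> [tB At]; rewrite nuB.
  have [tB|tB] := pselect (B t); first by rewrite nuB.
  by rewrite nuN// => /AS; rewrite /unit_sphere/= enorm0 => /eqP; rewrite eq_sym oner_eq0.
have mS : measurable (unit_sphere R n).
  rewrite (_ : unit_sphere R n = [set t | enorm t <= 1] `&` [set t | 1 <= enorm t]).
    by apply: measurableI; apply: measurable_le_set => //; exact: measurable_enorm.
  apply/seteqP; rewrite /unit_sphere; split=> t /=; first by move=> ->.
  by move=> tE; apply/eqP; rewrite eq_le; apply/andP.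
have mf : measurable_fun setT (fun w : V => (`|dotp e w| `^ p)%:E).
  apply/measurable_EFinP/(measurableT_comp (measurable_powR _)).
  apply: measurableT_comp => //; apply: measurable_dotp => //; exact: measurable_id.
have preS : nu @^-1` unit_sphere R n = B.
  apply/seteqP; split=> t; rewrite /unit_sphere/=.
    have [//|tB] := pselect (B t).
    by rewrite nuN// enorm0 => /eqP; rewrite eq_sym oner_eq0.
  move=> Bt; rewrite nuB// enorm_normalize// enorm_gt0P.
  by case/andP: Bt.
have mE : (\int[pushforward L nu]_(w in unit_sphere R n) (`|dotp e w| `^ p)%:E =
    \int[L]_(t in B) (dirpow e t)%:E)%E.
  rewrite (ge0_integral_pushforward mnu _ mS (measurable_funTS mf)) ?preS.
    by apply: eq_integral => t /set_mem Bt; rewrite /= nuB.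
  by move=> w _; rewrite lee_fin powR_ge0.
rewrite ge0_integral_mscale//; last exact: measurable_funTS.
by rewrite -[RHS]/(_ * \int[L]_(t in B) (dirpow e t)%:E)%E -mE.
Qed.

End difference_quotient_region.

(** * Passage to the limit *)

Section measure_limit.
Context d (T : measurableType d) {R : realType}.
Variable m : {measure set T -> \bar R}.
Local Open Scope ereal_scope.

Lemma integrable_indic_lty (A : set T) : measurable A -> m A < +oo ->
  m.-integrable setT (fun x => (\1_A x)%:E).
Proof.
move=> mA Aoo; apply/integrableP; split.
  exact/measurable_EFinP/measurable_indic.
under eq_integral do rewrite gee0_abs ?lee_fin//.
by rewrite integral_indic// setIT.
Qed.

(** Dominated convergence for indicators, whose pointwise convergence is eventual agreement of
    membership. *)
Lemma dominated_measure_cvg (A_ : (set T)^nat) (A D Z : set T) :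
  (forall k, measurable (A_ k)) -> measurable A -> measurable D ->
  m D < +oo -> (forall k, A_ k `<=` D) ->
  measurable Z -> m Z = 0 ->
  (forall t, ~ Z t -> \forall k \near \oo, A_ k t <-> A t) ->
  m (A_ k) @[k --> \oo] --> m A.
Proof.
move=> mA_ mA mD Doo AD mZ Z0 AA.
have [] := @dominated_convergence _ _ _ m setT measurableT
  (fun k t => (\1_(A_ k) t)%:E) (fun t => (\1_A t)%:E) (fun t => (\1_D t)%:E).
- by move=> k; exact/measurable_EFinP/measurable_indic.
- exact/measurable_EFinP/measurable_indic.
- exists Z; split=> // t /= tcvg; apply: contrapT => /AA tA.
  apply: tcvg => _; apply: cvg_near_cst.
  by apply: filterS tA => k kA; congr EFin; exact: eq_indic_iff.
- exact: integrable_indic_lty.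
- apply: aeW => t k _; rewrite gee0_abs ?lee_fin// !indicE ler_nat.
  by case: (boolP (t \in A_ k)) => // /set_mem/AD tD; rewrite mem_set.
move=> _ _; rewrite integral_indic// setIT.
by under eq_fun do rewrite integral_indic// setIT.
Qed.

End measure_limit.

(** * Sections of [E_set] at scale [eps] *)

Section rescaled_quotient.
Context {R : realType} {n : nat}.
Variables (p : R) (u : 'rV[R]_n -> R).
Hypotheses (n0 : (0 < n)%N) (p1 : 1 <= p).
Local Notation V := 'rV[R]_n.
Local Notation L := (@lebesgue_rV R n).

Let p0 : 0 < p.
Proof. exact: lt_le_trans p1. Qed.

Let nR0 : 0 < n%:R :> R.
Proof. by rewrite ltr0n. Qed.

(* The x-section of E_lambda, for lambda = eps^(-n/p), seen through
   y = x + eps t. *)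
Definition rescaled_section (eps : R) (x : V) : set V :=
  [set t | t <> 0 /\
    enorm t `^ (n%:R / p + 1) <= `|(u (x + eps *: t) - u x) / eps|].

Lemma measurable_E_set (lam : R) : measurable_fun setT u -> 0 < lam ->
  measurable (E_set p u lam).
Proof.
move=> mu l0.
have mB : measurable_fun setT (fun z : V * V => enorm (z.1 - z.2)).
  apply: measurable_enorm_comp; apply: measurable_rV_add; first exact: measurable_fst.
  by apply: measurable_rV_opp; exact: measurable_snd.
rewrite (_ : E_set p u lam = [set z | 0 < enorm (z.1 - z.2)] `&`
   [set z | lam * enorm (z.1 - z.2) `^ (n%:R / p + 1) <= `|u z.1 - u z.2|]).
  apply: measurableI; [apply: measurable_lt_set|apply: measurable_le_set] => //.
  - apply: measurable_funM => //; exact: (measurableT_comp (measurable_powR _)).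
  - apply: measurableT_comp => //; apply: measurable_funB.
    + exact: (measurableT_comp mu measurable_fst).
    + exact: (measurableT_comp mu measurable_snd).
apply/seteqP; split=> -[x y] /= [].
  move=> /eqP xy; have e0 : 0 < enorm (x - y).
    by apply: enorm_gt0; apply/eqP; rewrite subr_eq0.
  by rewrite ler_pdivlMr ?powR_gt0.
move=> e0; rewrite -ler_pdivlMr ?powR_gt0// => ?; split=> //= xy.
by move: e0; rewrite xy subrr enorm0 ltxx.
Qed.

(** The scale [eps = lam^(-p/n)] does two things at once: [eps^n] cancels the factor [lam^p], and
    [eps^(n/p) = 1 / lam] absorbs the threshold, leaving one factor [eps] for the difference
    quotient. *)
Lemma lebesgue_xsection_E_set (lam : R) x : measurable_fun setT u -> 0 < lam ->
  ((lam `^ p)%:E * L (xsection (E_set p u lam) x))%E =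
  L (rescaled_section (lam `^ (p / n%:R))^-1 x).
Proof.
move=> mu l0; set b := lam `^ (p / n%:R).
have b0 : 0 < b by rewrite powR_gt0.
have bn : b ^+ n = lam `^ p.
  by rewrite -powR_mulrn ?ltW// -powRrM divfK// gt_eqF.
have bnp : b `^ (n%:R / p) = lam.
  rewrite -powRrM (_ : p / n%:R * (n%:R / p) = 1) ?powRr1 ?ltW//.
  by field; rewrite !gt_eqF.
have mX : measurable (xsection (E_set p u lam) x).
  by apply: measurable_xsection; exact: measurable_E_set.
have mXs : measurable ((fun y => y + x) @^-1` xsection (E_set p u lam) x).
  rewrite -[X in measurable X]setTI.
  by apply: (@measurable_rV_add _ _ _ _ idfun (cst x)) => //; exact: measurable_id.
rewrite -(lebesgue_rV_shift x mX) -bn -[b in (b ^+ n)%:E]invrK.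
rewrite -lebesgue_rV_scale ?invr_gt0//; congr (lebesgue_rV n _).
have bd : b^-1 `^ (n%:R / p + 1) = (lam * b)^-1.
  rewrite -[b^-1]powR_inv1 ?ltW// -powRrM mulN1r powRN; congr (_^-1).
  by rewrite powRD ?(gt_eqF b0) ?implybT// bnp powRr1// ltW.
have bV0 : 0 < b^-1 by rewrite invr_gt0.
have E t : t <> 0 -> (lam <= `|u x - u (b^-1 *: t + x)| /
      enorm (x - (b^-1 *: t + x)) `^ (n%:R / p + 1)) =
    (enorm t `^ (n%:R / p + 1) <= `|(u (x + b^-1 *: t) - u x) / b^-1|).
  move=> /enorm_gt0 t0; rewrite opprD addrCA subrr addr0 enormN enormZ.
  rewrite (gtr0_norm bV0) powRM ?(ltW bV0) ?(ltW t0)// bd.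
  rewrite ler_pdivlMr ?mulr_gt0 ?invr_gt0 ?mulr_gt0 ?powR_gt0//.
  rewrite [_ + x]addrC distrC normrM invrK (gtr0_norm b0).
  by rewrite invfM mulrA mulrA divff ?gt_eqF// mul1r mulrC ler_pdivrMr.
have xt t : (x <> b^-1 *: t + x) <-> t <> 0.
  split=> tx xE; apply: tx; first by rewrite xE scaler0 add0r.
  have : b^-1 *: t = 0 by apply: (addIr x); rewrite add0r -xE.
  by move=> /eqP; rewrite scaler_eq0 invr_eq0 (gt_eqF b0)/= => /eqP.
apply/seteqP; split=> t; rewrite /xsection/= inE /E_set/rescaled_section/= xt.
  by move=> [t0]; rewrite E.
by move=> [t0]; rewrite -E.
Qed.

Lemma lebesgue_E_set (lam : R) : measurable_fun setT u -> 0 < lam ->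
  ((lam `^ p)%:E * (lebesgue_rV n \x lebesgue_rV n) (E_set p u lam) =
   \int[L]_x L (rescaled_section (lam `^ (p / n%:R))^-1 x))%E.
Proof.
move=> mu l0; have mE := measurable_E_set mu l0.
under eq_integral do rewrite -lebesgue_xsection_E_set//.
rewrite ge0_integralZl//; first exact: measurable_fun_xsection.
by rewrite lee_fin powR_ge0.
Qed.

(** Measurability in [x] is inherited from the sections of [E_set], hence the form of the scale. *)
Lemma measurable_lebesgue_rescaled_section (lam : R) :
  measurable_fun setT u -> 0 < lam ->
  measurable_fun setT
    (fun x => L (rescaled_section (lam `^ (p / n%:R))^-1 x)).
Proof.
move=> mu l0.
under eq_fun do rewrite -lebesgue_xsection_E_set//.
by apply: measurable_funeM; apply: measurable_fun_xsection; exact: measurable_E_set.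
Qed.

Lemma measurable_rescaled_section (eps : R) x : measurable_fun setT u ->
  measurable (rescaled_section eps x).
Proof.
move=> mu; rewrite (_ : rescaled_section _ _ = [set t | 0 < enorm t] `&`
  [set t | enorm t `^ (n%:R / p + 1) <= `|(u (x + eps *: t) - u x) / eps|]).
  apply: measurableI; [apply: measurable_lt_set|apply: measurable_le_set] => //.
  - exact: measurable_enorm.
  - by apply: (measurableT_comp (measurable_powR _)); exact: measurable_enorm.
  - apply: measurableT_comp => //; apply: measurable_funM => //.
    apply: measurable_funB => //; apply: (measurableT_comp mu).
    apply: (@measurable_rV_add _ _ _ _ (cst x)) => //.
    by apply: measurable_rV_scale => //; exact: measurable_id.
by apply/seteqP; split=> t [/enorm_gt0P].
Qed.

(** The Lipschitz bound gives [|t|^(n/p+1) <= M |t|], hence [|t|^(n/p) <= M], whatever [eps] and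
    [x]. *)
Lemma rescaled_section_bounded (M eps : R) x t : 0 < eps -> 0 <= M ->
  (forall x h, `|u (x + h) - u x| <= M * enorm h) ->
  rescaled_section eps x t -> enorm t <= M `^ (p / n%:R).
Proof.
move=> eps0 M0 lip [/enorm_gt0 t0] tE.
have : enorm t `^ (n%:R / p) <= M.
  rewrite -(ler_pM2r t0); apply: le_trans (_ : enorm t `^ (n%:R / p + 1) <= _).
    by rewrite powRD ?powRr1 ?(gt_eqF t0) ?implybT// ltW.
  apply: (le_trans tE); rewrite normrM normfV (gtr0_norm eps0) ler_pdivrMr//.
  by rewrite (le_trans (lip _ _))// enormZ (gtr0_norm eps0) [eps * _]mulrC mulrA.
move=> tM.
have -> : enorm t = (enorm t `^ (n%:R / p)) `^ (p / n%:R).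
  rewrite -powRrM (_ : n%:R / p * (p / n%:R) = 1) ?powRr1 ?ltW//.
  by field; rewrite !gt_eqF.
by apply: ge0_ler_powR => //; rewrite ?nnegrE ?powR_ge0// divr_ge0// ltW.
Qed.

(** If [u] vanished at both [x] and [x + eps *: t] the quotient would be 0, against [t <> 0]. So one
    of the two points is in the support, and [eps <= 1] keeps [x] within [S] of it. *)
Lemma rescaled_section_support (r S eps : R) x t : 0 < eps <= 1 ->
  (forall x, u x != 0 -> forall i, `|x ord0 i| <= r) ->
  rescaled_section eps x t -> enorm t <= S ->
  box n (- (r + S)) (r + S + 1) x.
Proof.
move=> /andP[eps0 eps1] supp [/enorm_gt0 t0 tE] tS i.
suff : `|x ord0 i| <= r + S by rewrite ler_norml => /andP[-> ?]/=; lra.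
have S0 : 0 < S by exact: lt_le_trans tS.
have [ux|ux] := eqVneq (u x) 0; last by rewrite (le_trans (supp x ux i))//; lra.
have : u (x + eps *: t) != 0.
  apply: contraTneq tE => ->; rewrite ux subrr mul0r normr0 -ltNge.
  by rewrite powR_gt0.
move=> /supp/(_ i); rewrite !mxE => xr.
rewrite -(addrK (eps * t ord0 i) (x ord0 i)) (le_trans (ler_normB _ _))//.
rewrite lerD// normrM (gtr0_norm eps0) (le_trans _ tS)//.
by rewrite (le_trans _ (coord_le_enorm t i))// ler_piMl.
Qed.

End rescaled_quotient.

Section BvSY_limit.
Context {R : realType} {n : nat}.
Variables (p : R) (u : 'rV[R]_n -> R).
Hypotheses (n0 : (0 < n)%N) (p1 : 1 <= p).
Hypotheses (C1 : class_C 1 u) (cs : compactly_supported u).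
Hypothesis S0 : unit_sphere R n !=set0.
Local Notation L := (@lebesgue_rV R n).

Let p0 : 0 < p.
Proof. exact: lt_le_trans p1. Qed.

Let mu : measurable_fun setT u.
Proof. by apply: continuous_measurable_rV; case: C1. Qed.

Lemma measurable_grad_energy :
  measurable_fun setT (fun x => (enorm (grad u x) `^ p)%:E).
Proof.
apply/measurable_EFinP/(measurableT_comp (measurable_powR _)).
apply/measurable_enorm_comp/measurable_fun_coordP => i.
under eq_fun do rewrite mxE.
by apply: continuous_measurable_rV; case: C1 => _ /(_ i)[].
Qed.

Lemma lebesgue_rescaled_section_cvg (M : R) (eps : R^nat) x : 0 <= M ->
  (forall x h, `|u (x + h) - u x| <= M * enorm h) ->
  (forall k, 0 < eps k) -> eps @ \oo --> (0 : R) ->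
  L (rescaled_section p u (eps k) x) @[k --> \oo] -->
  L (quotient_region p (grad u x)).
Proof.
move=> M0 lip eps0 epscvg.
pose D : set 'rV[R]_n := [set t | enorm t <= M `^ (p / n%:R)].
apply: (@dominated_measure_cvg _ _ _ L _ _ D (quotient_boundary p (grad u x))).
- by move=> k; exact: measurable_rescaled_section.
- exact: measurable_quotient_region.
- by apply: measurable_le_set => //; exact: measurable_enorm.
- exact: lebesgue_rV_ball_lty.
- move=> k t tk; exact: (rescaled_section_bounded n0 p1 (eps0 k) M0 lip tk).
- exact: measurable_quotient_boundary.
- exact: lebesgue_quotient_boundary.
(* The origin is outside the boundary set, but it belongs to none of the regions. *)
move=> t tZ; have [t0|t0] := pselect (t = 0).
  by apply: nearW => k; split=> -[].
have tcvg : `|(u (x + eps k *: t) - u x) / eps k| @[k --> \oo] -->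
    `|dotp (grad u x) t|.
  by apply: cvg_norm; exact: class_C1_directional_cvg.
have [tlt|tgt|teq] := ltgtP (enorm t `^ (n%:R / p + 1)) `|dotp (grad u x) t|.
- apply: filterS (cvgr_gt _ tcvg _ tlt) => k kt.
  by split=> _; split=> //; exact: ltW.
- apply: filterS (cvgr_lt _ tcvg _ tgt) => k kt.
  by split=> -[_]; rewrite leNgt ?kt ?tgt.
- by exfalso; apply: tZ.
Qed.

(** The bound [1 <= lam k] gives [eps k <= 1], so that the sections are empty for [x] outside one
    fixed box. *)
Lemma lebesgue_E_set_cvg (lam : R^nat) : (forall k, 1 <= lam k) ->
  lam @ \oo --> +oo ->
  ((lam k `^ p)%:E * (lebesgue_rV n \x lebesgue_rV n) (E_set p u (lam k)))%E
    @[k --> \oo] --> (\int[L]_x L (quotient_region p (grad u x)))%E.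
Proof.
move=> lam1 lamoo.
have lam0 k : 0 < lam k by exact: lt_le_trans (lam1 k).
pose a := p / n%:R.
have a0 : 0 < a by rewrite divr_gt0// ltr0n.
pose eps k := (lam k `^ a)^-1.
have eps0 k : 0 < eps k by rewrite invr_gt0 powR_gt0.
have eps1 k : 0 < eps k <= 1.
  rewrite eps0 invf_le1 ?powR_gt0// -[leLHS](powRr0 (lam k)).
  by apply: ler_powR => //; exact: ltW.
have epscvg : eps @ \oo --> (0 : R).
  apply/gtr0_cvgV0; first by apply: nearW => k; rewrite powR_gt0.
  apply/cvgryPge => A; move/cvgryPge : lamoo => /(_ (`|A| `^ a^-1)).
  apply: filterS => k Ak; apply: (le_trans (ler_norm A)).
  have -> : `|A| = (`|A| `^ a^-1) `^ a.
    by rewrite -powRrM mulVf ?gt_eqF// powRr1.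
  by apply: ge0_ler_powR; rewrite ?nnegrE ?powR_ge0// ltW.
have [M M0 DM] := compactly_supported_partial_bounded C1 cs.
have lip := class_C1_lipschitz C1 DM.
have nM0 : 0 <= n%:R * M by rewrite mulr_ge0.
have [r supp] := compactly_supported_bounded cs.
pose S := (n%:R * M) `^ a.
pose D := [set t : 'rV[R]_n | enorm t <= S].
have Dlty : (L D < +oo)%E := @lebesgue_rV_ball_lty R n S.
pose B := box n (- (r + S)) (r + S + 1).
(* The dominating function in [x]: the ball [D] contains every section, and sections over points
   outside [B] are empty. *)
have Qle k x : (L (rescaled_section p u (eps k) x) <= (\1_B x)%:E * L D)%E.
  have [xB|xB] := pselect (B x).
    rewrite indicE mem_set// mul1e; apply: le_measure; rewrite ?inE.
    - exact: measurable_rescaled_section.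
    - by apply: measurable_le_set => //; exact: measurable_enorm.
    - by move=> t; exact: (rescaled_section_bounded n0 p1 (eps0 k) nM0 lip).
  rewrite (_ : rescaled_section _ _ _ _ = set0) ?measure0 ?mule_ge0 ?lee_fin//.
  rewrite -subset0 => t tQ; apply: xB.
  apply: (rescaled_section_support (eps1 k) supp tQ).
  exact: (rescaled_section_bounded n0 p1 (eps0 k) nM0 lip tQ).
under eq_fun do rewrite lebesgue_E_set//.
have [e e1] := S0.
have mgrad : measurable_fun setT (fun x => L (quotient_region p (grad u x))).
  under eq_fun do rewrite (lebesgue_quotient_regionE n0 p1 _ e1).
  by apply: emeasurable_funM => //; exact: measurable_grad_energy.
have [] // := @dominated_convergence _ _ _ L setT measurableT
  (fun k x => L (rescaled_section p u (eps k) x))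
  (fun x => L (quotient_region p (grad u x)))
  (fun x => (\1_B x)%:E * L D)%E.
- by move=> k; exact: measurable_lebesgue_rescaled_section.
- apply: aeW => x _; exact: (lebesgue_rescaled_section_cvg nM0 lip).
- have -> : L D = (fine (L D))%:E by rewrite fineK// ge0_fin_numE.
  apply: integrableZr => //; apply: integrable_indic_lty; first exact: measurable_box.
  exact: lebesgue_rV_box_lty.
- by apply: aeW => x k _; rewrite gee0_abs.
Qed.

End BvSY_limit.

Theorem theorem1p2 (R : realType) (N : nat) (p : R) (u : 'rV[R]_N -> R)
    (e : 'rV[R]_N) :
  (1 <= N)%N -> 1 <= p ->
  smooth u -> compactly_supported u ->
  unit_sphere R N e ->
  ((lambda `^ p)%:E * (lebesgue_rV N \x lebesgue_rV N) (E_set p u lambda))%E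
    @[lambda --> +oo] -->
  (k_const p e * (N%:R^-1)%:E * gradient_energy p u)%E.
Proof.
move=> N0 p1 /(_ 1%N) C1 cs e1.
have S0 : unit_sphere R N !=set0 by exists e.
have -> : (k_const p e * (N%:R^-1)%:E * gradient_energy p u =
    \int[lebesgue_rV N]_x lebesgue_rV N (quotient_region p (grad u x)))%E.
  have mgrad : measurable_fun setT (fun x => (enorm (grad u x) `^ p)%:E).
    exact: measurable_grad_energy.
  have voo := lebesgue_quotient_region_unit_lty N0 p1 e1.
  rewrite (k_constE N0 p1 e1) /gradient_energy.
  under [RHS]eq_integral do rewrite (lebesgue_quotient_regionE N0 p1 _ e1).
  rewrite ge0_integralZr//; last by move=> x _; rewrite lee_fin powR_ge0.
  rewrite muleC; congr (_ * _)%E.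
  rewrite muleAC -EFinM mulfV ?mul1e// pnatr_eq0 -lt0n.
  exact: N0.
apply/cvge_pinftyP => lam lamoo.
(* [lebesgue_E_set_cvg] asks for a lower bound at every index; truncating at 1 alters only finitely
   many terms. *)
pose lam' k := Order.max 1 (lam k).
have lam'E : \forall k \near \oo, lam' k = lam k.
  move/cvgryPge : lamoo => /(_ 1); apply: filterS => k.
  by rewrite /lam' => /max_r.
have lam'1 k : 1 <= lam' k by rewrite le_max lexx.
have lam'oo : lam' @ \oo --> +oo.
  apply: cvg_trans lamoo; apply: near_eq_cvg.
  by apply: filterS lam'E => k ->.
apply: cvg_trans (lebesgue_E_set_cvg N0 p1 C1 cs S0 lam'1 lam'oo).
by apply: near_eq_cvg; apply: filterS lam'E => k ->.
Qed.
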